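(* There exist universal constants $0<c\le C<\infty$ such that the following holds for all $L,R>0$, all $T\in\mathbb{N}$, every instance class $\mathcal{I}\in\{\mathcal{I}_{\mathsf{Lip}}^{L,R},\mathcal{I}_{\mathsf{SM\text{-}Lip}}^{L,R}\}$ and every algorithm class $\mathcal{A}\in\{\mathcal{A}_{\mathsf{SO}},\mathcal{A}_{\mathsf{SFO}}\}$: $$c\,\frac{LR}{\sqrt T}\;\le\;\mathsf{Err}_T^{\mathbb{E}}(\mathcal{A},\mathcal{I})\;\le\; C\,\frac{LR}{\sqrt T},$$ and, for every $\delta\in(0,\tfrac12)$, $$c\,\frac{LR}{\sqrt{1+T/\log\frac1\delta}}\;\le\;\mathsf{Err}_T^{\delta}(\mathcal{A},\mathcal{I})\;\le\; C\,\frac{LR}{\sqrt{1+T/\log\frac1\delta}}.$$ Here the upper bounds hold for every closed convex domain $\mathcal{X}\subseteq\mathbb{R}^d$ with $0\in\mathcal{X}$ (any $d\ge 1$), and the lower bounds are for the domain $\mathcal{X}=\mathbb{R}$.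
   Context: Here $\mathbb{N}=\{1,2,\dots\}$, $\log$ is the natural logarithm, $\|\cdot\|$ is the Euclidean norm, and the domain $\mathcal{X}$ is a fixed closed convex set. Stochastic optimization (SO) instances. An SO instance is a pair $(f,P)$, where $P$ is a probability distribution on a sample space $\mathcal{S}$ and $f:\mathcal{X}\times\mathcal{S}\to\mathbb{R}$ is such that $F_{f,P}(x):=\mathbb{E}_{S\sim P}f(x;S)$ is well defined and finite for all $x\in\mathcal{X}$. Let $X^\star_{f,P}:=\arg\min_{x\in\mathcal{X}}F_{f,P}(x)$. The norm of a set means the infimum of the norms of its elements ($\infty$ for the empty set). Each convex sample function $f(\cdot;s)$ comes with an arbitrary (measurable) subgradient selection $\nabla f(x;s)\in\partial f(x;s)$, regarded as part of the instance. For $L,R>0$: $\mathcal{I}_{\mathsf{Lip}}^{L,R}$ is the class of instances such that $f(\cdot;s)$ is convex and $L$-Lipschitz on $\mathcal{X}$ for all $s\in\mathcal{S}$ (with selected subgradients of norm at most $L$, which is automatic at interior points of $\mathcal{X}$), and $\|X^\star_{f,P}\|\le R$; $\mathcal{I}_{\mathsf{SM\text{-}Lip}}^{L,R}$ is the class of instances such that $f(\cdot;s)$ is convex for all $s\in\mathcal{S}$, $\mathbb{E}_{S\sim P}\|\nabla f(x;S)\|^2\le L^2$ for all $x\in\mathcal{X}$, and $\|X^\star_{f,P}\|\le R$. Algorithms. Let $S_1,\dots,S_T$ be i.i.d. from $P$ and let $\xi\sim\mathsf{Unif}([0,1])$ be independent of them. $\mathcal{A}_{\mathsf{SO}}$ is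 the set of all SO algorithms, whose output is $x_T=\mathsf{alg}_T(f(\cdot;S_1),\dots,f(\cdot;S_T);\xi)\in\mathcal{X}$ for some measurable mapping $\mathsf{alg}_T$ (the sample functions are given together with their subgradient selections). $\mathcal{A}_{\mathsf{SFO}}\subset\mathcal{A}_{\mathsf{SO}}$ is the set of stochastic first-order algorithms, which start at $x_0=0$ and whose iterates are $x_t=\mathsf{alg}_t(\nabla f(x_0;S_1),\dots,\nabla f(x_{t-1};S_t);\xi)\in\mathcal{X}$ for $t=1,\dots,T$, with measurable mappings $\mathsf{alg}_t$; the output is $x_T$. The mappings may depend on $T,L,R,\delta$ (all known). Errors. $\mathsf{Err}_T^{\mathbb{E}}(\mathsf{alg},(f,P)):=\mathbb{E}F_{f,P}(x_T)-\inf_{x\in\mathcal{X}}F_{f,P}(x)$ and $\mathsf{Err}_T^{\delta}(\mathsf{alg},(f,P)):=Q_{1-\delta}(F_{f,P}(x_T))-\inf_{x\in\mathcal{X}}F_{f,P}(x)$, where $Q_p(Y):=\min\{y:\mathbb{P}(Y\le y)\ge p\}$. For either error, $\mathsf{Err}_T(\mathsf{alg},\mathcal{I}):=\sup_{(f,P)\in\mathcal{I}}\mathsf{Err}_T(\mathsf{alg},(f,P))$ and $\mathsf{Err}_T(\mathcal{A},\mathcal{I}):=\inf_{\mathsf{alg}\in\mathcal{A}}\mathsf{Err}_T(\mathsf{alg},\mathcal{I})$. *)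

(* Defs.v *)
From HB Require Import structures.
From mathcomp Require Import all_boot all_order all_algebra.
From mathcomp Require Import all_classical all_reals all_analysis.

Set Implicit Arguments.
Unset Strict Implicit.
Unset Printing Implicit Defensive.

Import Order.TTheory GRing.Theory Num.Theory.
Import numFieldNormedType.Exports.

Local Open Scope classical_set_scope.
Local Open Scope ring_scope.

(* The library has no measurable structure on matrices; R^d = 'rV[R]_d gets
   its Borel sigma-algebra. *)
Definition borel_mx_display : measure_display.
Proof. exact: default_measure_display. Qed.

Section borel_mx.
Context (R : realType) (m n : nat).

Let borel_mx0 : <<s @open 'M[R]_(m, n) >> set0.
Proof. exact: sigma_algebra0. Qed.

Let borel_mxC A :
  <<s @open 'M[R]_(m, n) >> A -> <<s @open 'M[R]_(m, n) >> (~` A).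
Proof. exact: sigma_algebraC. Qed.

Let borel_mx_bigcup (F : (set 'M[R]_(m, n))^nat) :
  (forall i, <<s @open 'M[R]_(m, n) >> (F i)) ->
  <<s @open 'M[R]_(m, n) >> (\bigcup_i F i).
Proof. exact: sigma_algebra_bigcup. Qed.

HB.instance Definition _ := @isMeasurable.Build borel_mx_display
  'M[R]_(m, n) <<s @open 'M[R]_(m, n) >> borel_mx0 borel_mxC borel_mx_bigcup.

End borel_mx.

(* The library norm `|x| on 'rV[R]_d is the sup norm: it induces the right
   topology but is not the Euclidean norm. *)
Definition dotv (R : realType) (d : nat) (u v : 'rV[R]_d) : R :=
  \sum_(i < d) u 0 i * v 0 i.

Definition enorm (R : realType) (d : nat) (v : 'rV[R]_d) : R :=
  Num.sqrt (dotv v v).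

(* +oo for the empty set *)
Definition set_enorm (R : realType) (d : nat) (A : set 'rV[R]_d) : \bar R :=
  ereal_inf [set (enorm x)%:E | x in A].

Definition elipschitz_on (R : realType) (d : nat) (X : set 'rV[R]_d) (L : R)
    (h : 'rV[R]_d -> R) : Prop :=
  forall x y, X x -> X y -> `|h x - h y| <= L * enorm (x - y).

Definition subgradient (R : realType) (d : nat) (X : set 'rV[R]_d)
    (h : 'rV[R]_d -> R) (x v : 'rV[R]_d) : Prop :=
  forall y, X y -> h x + dotv v (y - x) <= h y.

(* The law of T i.i.d. samples S_1, ..., S_T of law P, as a product measure on
   tuples. *)
Definition cons_pair (S : Type) (n : nat) (p : S * n.-tuple S) : n.+1.-tuple S :=
  [tuple of p.1 :: p.2].

Section cons_pair_measurable.
Context d (S : measurableType d) (n : nat).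

Let measurable_cons_pair : measurable_fun setT (@cons_pair S n).
Proof. exact: measurable_cons. Qed.

HB.instance Definition _ := isMeasurableFun.Build _ _ _ _ (@cons_pair S n)
  measurable_cons_pair.

End cons_pair_measurable.

Fixpoint iid_law (R : realType) d (S : measurableType d) (P : probability S R)
    (n : nat) : probability (n.-tuple S) R :=
  if n is n'.+1 then
    distribution (P \x iid_law P n')%E (@cons_pair S n')
  else \d_([tuple] : 0.-tuple S).

(* Sample functions live on X: the values of so_f and so_grad outside X are
   irrelevant and are never used below.  The gradient selection is part of the
   instance, and its measurability is joint in (x, s), so that the iterates of
   first-order algorithms are random variables. *)
Record so_instance (R : realType) (d : nat) (X : set 'rV[R]_d) := SoInstance {
  so_disp : measure_display;
  so_space : measurableType so_disp;
  so_law : probability so_space R;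
  so_f : 'rV[R]_d -> so_space -> R;
  so_grad : 'rV[R]_d -> so_space -> 'rV[R]_d;
  so_f_integrable : forall x, X x ->
    so_law.-integrable setT (fun s => (so_f x s)%:E);
  so_grad_measurable : measurable_fun (X `*` [set: so_space])
    (fun p : 'rV[R]_d * so_space => so_grad p.1 p.2);
  so_grad_subgradient : forall s, convex_function X (so_f ^~ s) ->
    forall x, X x -> subgradient X (so_f ^~ s) x (so_grad x s)
}.

Arguments so_f {R d X} _ _ _.
Arguments so_grad {R d X} _ _ _.

Section objective.
Context (R : realType) (d : nat) (X : set 'rV[R]_d) (I : so_instance X).

Definition so_objective (x : 'rV[R]_d) : R := fine 'E_(so_law I)[so_f I x].

Definition so_argmin : set 'rV[R]_d :=
  [set x | X x /\ forall y, X y -> so_objective x <= so_objective y].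

Definition so_inf : \bar R := ereal_inf [set (so_objective x)%:E | x in X].

Definition so_convex : Prop := forall s, convex_function X (so_f I ^~ s).

End objective.

(* Classes of instances are Prop-valued predicates and not sets: the universe of
   so_instance X is too large for the library's type of sets.  The radius bounding
   the norm of the set of minimizers is called B. *)
Definition instances_Lip (R : realType) (d : nat) (X : set 'rV[R]_d) (L B : R)
    (I : so_instance X) : Prop :=
  [/\ so_convex I,
    forall s, elipschitz_on X L (so_f I ^~ s),
    forall s x, X x -> enorm (so_grad I x s) <= L &
    (set_enorm (so_argmin I) <= B%:E)%E].

Definition instances_SMLip (R : realType) (d : nat) (X : set 'rV[R]_d)
    (L B : R) (I : so_instance X) : Prop :=
  [/\ so_convex I,
    forall x, X x ->
      ('E_(so_law I)[fun s => (enorm (so_grad I x s) ^+ 2)%R] <= (L ^+ 2)%:E)%E &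
    (set_enorm (so_argmin I) <= B%:E)%E].

(* A sample function together with its subgradient selection; algorithms only
   see the restriction to X of both components (constant outside X). *)
Definition sample_fun (R : realType) (d : nat) : Type :=
  (('rV[R]_d -> R) * ('rV[R]_d -> 'rV[R]_d))%type.

Definition observed (R : realType) (d : nat) (X : set 'rV[R]_d)
    (I : so_instance X) (s : so_space I) : sample_fun R d :=
  ((so_f I ^~ s) \_ X, (so_grad I ^~ s) \_ X).

(* The internal randomness xi has law Unif[0,1]; mappings are taken total in
   xi : R, the values for xi outside [0,1] being irrelevant. *)
Definition so_alg (R : realType) (d T : nat) : Type :=
  T.-tuple (sample_fun R d) -> R -> 'rV[R]_d.

Definition so_output (R : realType) (d T : nat) (X : set 'rV[R]_d)
    (alg : so_alg R d T) (I : so_instance X)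
    (w : T.-tuple (so_space I) * measurableTypeR R) : 'rV[R]_d :=
  alg [tuple of map (@observed R d X I) w.1] w.2.

(* A mapping that takes functions as arguments is measurable when its output is
   a random variable on every convex instance, i.e. when it is measurable for
   the finest sigma-algebra on inputs (z, xi) under which the random input
   (f(.; S_1), ..., f(.; S_T), xi) of every convex instance is measurable. *)
Definition algs_SO (R : realType) (d T : nat) (X : set 'rV[R]_d) :
    set (so_alg R d T) :=
  [set alg | (forall z u, X (alg z u)) /\
    forall I : so_instance X, so_convex I ->
      measurable_fun setT (@so_output R d T X alg I)].

Section first_order.
Context (R : realType) (d : nat).
Variable alg : forall t : nat, t.-tuple 'rV[R]_d -> R -> 'rV[R]_d.

(* x_t as a function of the t gradients observed so far, with x_0 = 0 *)
Definition sfo_iterate (t : nat) (h : t.-tuple 'rV[R]_d) (u : R) : 'rV[R]_d :=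
  if t == 0%N then 0 else alg h u.

(* The first t observed gradients; z lists the sample functions, and the
   default value of nth is never reached for t <= size z. *)
Fixpoint sfo_history (z : seq (sample_fun R d)) (u : R) (t : nat) :
    t.-tuple 'rV[R]_d :=
  if t is t'.+1 then
    let h := sfo_history z u t' in
    [tuple of rcons h ((nth (cst 0, cst 0) z t').2 (sfo_iterate h u))]
  else [tuple].

Definition sfo_output (T : nat) : so_alg R d T :=
  fun z u => sfo_iterate (sfo_history z u T) u.

End first_order.

Definition algs_SFO (R : realType) (d T : nat) (X : set 'rV[R]_d) :
    set (so_alg R d T) :=
  [set A | exists alg : forall t : nat, t.-tuple 'rV[R]_d -> R -> 'rV[R]_d,
    (forall t : nat, (0 < t <= T)%N ->
      (forall h u, X (alg t h u)) /\
      measurable_fun setT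
        (fun hu : t.-tuple 'rV[R]_d * measurableTypeR R => alg t hu.1 hu.2)) /\
    A = sfo_output alg (T := T)].

(* Joint law of ((S_1, ..., S_T), xi). *)
Definition run_law (R : realType) (d T : nat) (X : set 'rV[R]_d)
    (I : so_instance X) :
    probability (T.-tuple (so_space I) * measurableTypeR R)%type R :=
  (iid_law (so_law I) T \x uniform_prob (@ltr01 R))%E.

(* Q_p(Y) = min {y : Pr(Y <= y) >= p}; the infimum is attained for 0 < p < 1,
   by right-continuity of the cdf. *)
Definition quantile (R : realType) d (T : measurableType d)
    (Pr : probability T R) (p : R) (Y : T -> R) : \bar R :=
  ereal_inf [set y%:E | y in [set y | (p%:E <= Pr [set w | (Y w <= y)%R])%E]].

Section errors.
Context (R : realType) (d T : nat) (X : set 'rV[R]_d).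

Definition err_mean (alg : so_alg R d T) (I : so_instance X) : \bar R :=
  ('E_(run_law T I)[fun w => so_objective I (so_output alg w)] - so_inf I)%E.

Definition err_quantile (delta : R) (alg : so_alg R d T) (I : so_instance X) :
    \bar R :=
  (quantile (run_law T I) (1 - delta)
     (fun w => so_objective I (so_output alg w)) - so_inf I)%E.

Definition minimax_err (err : so_alg R d T -> so_instance X -> \bar R)
    (algs : set (so_alg R d T)) (insts : so_instance X -> Prop) : \bar R :=
  ereal_inf [set ereal_sup [set e | exists2 I, insts I & e = err alg I]
            | alg in algs].

End errors.

(* Main.v *)
(* Upper bounds.  Projected stochastic subgradient descent on X /\ {|x| <= 2B}, where an
   observed gradient longer than la is replaced by 0, outputs the average of its iterates.
   With r = sqrt (l / T), la = L / r, step size eta = B r / L and th = r / (20 L B), one step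
   multiplies the conditional expectation of, for a minimizer z,
     exp (th * (sum of past excesses + |x_t - z|^2 / (2 eta)))
   by at most exp (r^2): truncation keeps the exponent bounded by 1/2 and costs a bias
   L^2 / la only.  Hence E exp (th T (F(x_T) - F(z))) <= exp (1/10 + l), uniformly over the
   instances with second moment at most L^2.  Markov's inequality with l = log (1/del)
   gives the quantile bound, and l = 1 gives the bound in expectation.

   Lower bounds.  The sample functions are (L/2) (|x - B| + e |x|) and
   (L/2) (|x + B| + e |x|), drawn with probabilities q and 1 - q for q = 1/2, 1/2 + e, 1/2 - e.
   The three sets of points with excess below L B e / 4 are disjoint.  Under q = 1/2 either the
   output misses the first set with probability at least 1/2, or it misses one of the others
   with probability at least 3/4; in the latter case a chi^2 change of measure bounds the
   corresponding probability under q = 1/2 +- e below by (9/16) (1 - 4 e^2)^T.  Three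
   hypotheses are needed because del may be close to 1/2: a coin flip between two
   hypotheses succeeds with probability 1/2. *)
Require Import Defs.
From mathcomp Require Import all_boot all_order all_algebra.
From mathcomp Require Import all_classical all_reals all_analysis.
From mathcomp Require Import measurable_realfun ring lra.

Import Order.TTheory GRing.Theory Num.Theory.
Import numFieldNormedType.Exports.

Local Open Scope classical_set_scope.
Local Open Scope ring_scope.

Set Implicit Arguments.
Unset Strict Implicit.
Unset Printing Implicit Defensive.


(** * Euclidean geometry and Borel sets of R^d *)

Section euclidean.
Context {R : realType} {d : nat}.
Implicit Types (u v w x y z : 'rV[R]_d) (a : R).

Lemma dotvC u v : dotv u v = dotv v u.
Proof. by apply: eq_bigr => i _; rewrite mulrC. Qed.

Lemma dotvDl u v w : dotv (u + v) w = dotv u w + dotv v w.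
Proof. by rewrite /dotv -big_split; apply: eq_bigr => i _; rewrite mxE mulrDl. Qed.

Lemma dotvZl a u w : dotv (a *: u) w = a * dotv u w.
Proof. by rewrite /dotv mulr_sumr; apply: eq_bigr => i _; rewrite mxE mulrA. Qed.

Lemma dotvNl u w : dotv (- u) w = - dotv u w.
Proof. by rewrite -scaleN1r dotvZl mulN1r. Qed.

Lemma dotvBl u v w : dotv (u - v) w = dotv u w - dotv v w.
Proof. by rewrite dotvDl dotvNl. Qed.

Lemma dotvDr u v w : dotv w (u + v) = dotv w u + dotv w v.
Proof. by rewrite dotvC dotvDl !(dotvC w). Qed.

Lemma dotvZr a u w : dotv w (a *: u) = a * dotv w u.
Proof. by rewrite dotvC dotvZl dotvC. Qed.

Lemma dotvNr u w : dotv w (- u) = - dotv w u.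
Proof. by rewrite dotvC dotvNl dotvC. Qed.

Lemma dotvBr u v w : dotv w (u - v) = dotv w u - dotv w v.
Proof. by rewrite dotvDr dotvNr. Qed.

Lemma dot0v w : dotv 0 w = 0.
Proof. by rewrite -(scale0r w) dotvZl mul0r. Qed.

Lemma dotv_ge0 v : 0 <= dotv v v.
Proof. by apply: sumr_ge0 => i _; rewrite -expr2 sqr_ge0. Qed.

Lemma enorm_ge0 v : 0 <= enorm v.
Proof. exact: sqrtr_ge0. Qed.

Lemma enorm_sqr v : enorm v ^+ 2 = dotv v v.
Proof. by rewrite sqr_sqrtr// dotv_ge0. Qed.

Lemma enormN v : enorm (- v) = enorm v.
Proof. by rewrite /enorm dotvNl dotvNr opprK. Qed.

Lemma enormB u v : enorm (u - v) = enorm (v - u).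
Proof. by rewrite -enormN opprB. Qed.

Lemma enorm0 : enorm (0 : 'rV[R]_d) = 0.
Proof. by rewrite /enorm dot0v sqrtr0. Qed.

Lemma coord_le_enorm v i : `|v 0 i| <= enorm v.
Proof.
rewrite -sqrtr_sqr ler_sqrt ?dotv_ge0// /dotv (bigD1 i)//= -expr2 lerDl.
by apply: sumr_ge0 => j _; rewrite -expr2 sqr_ge0.
Qed.

Lemma enorm_eq0 v : enorm v = 0 -> v = 0.
Proof.
move=> v0; apply/rowP => i; rewrite mxE; apply/eqP.
by rewrite -normr_le0 -v0 coord_le_enorm.
Qed.

(** Cauchy-Schwarz: once zero vectors are set aside, expand the nonnegative square of
    [enorm v *: u - enorm u *: v] and cancel the product of the norms. *)
Lemma dotv_le u v : dotv u v <= enorm u * enorm v.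
Proof.
have [u0|u0] := eqVneq (enorm u) 0.
  by rewrite (enorm_eq0 u0) dot0v enorm0 mul0r.
have [v0|v0] := eqVneq (enorm v) 0.
  by rewrite (enorm_eq0 v0) dotvC dot0v enorm0 mulr0.
have uv : 0 < enorm u * enorm v by rewrite mulr_gt0// lt_neqAle eq_sym ?u0 ?v0 enorm_ge0.
have := dotv_ge0 (enorm v *: u - enorm u *: v).
rewrite dotvBl !dotvBr !dotvZl !dotvZr -!enorm_sqr (dotvC v u) => h.
rewrite -(ler_pM2l uv); nra.
Qed.

Lemma ler_enormD u v : enorm (u + v) <= enorm u + enorm v.
Proof.
rewrite -(@ler_pXn2r _ 2) ?nnegrE ?addr_ge0 ?enorm_ge0//.
rewrite enorm_sqr dotvDl !dotvDr -!enorm_sqr (dotvC v u).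
have := dotv_le u v; nra.
Qed.

Lemma normr_dotv_le u v : `|dotv u v| <= enorm u * enorm v.
Proof. by rewrite ler_norml dotv_le andbT -(enormN u) lerNl -dotvNl dotv_le. Qed.

Lemma dotvBZ_sqr (t : R) u v :
  dotv (u - t *: v) (u - t *: v) = dotv u u - t * (dotv u v *+ 2 - t * dotv v v).
Proof. by rewrite !(dotvBl, dotvBr, dotvZl, dotvZr) (dotvC v u); ring. Qed.

Lemma enormZ a v : enorm (a *: v) = `|a| * enorm v.
Proof.
by rewrite /enorm dotvZl dotvZr mulrA -expr2 sqrtrM ?sqr_ge0// sqrtr_sqr.
Qed.

(** The triangle inequality over the coordinates. The crude factor [d] is enough, since the bound
    only serves to pass from Euclidean Lipschitz estimates to continuity in the topology of the sup
    norm. *)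
Lemma enorm_le_norm v : enorm v <= d%:R * `|v|.
Proof.
have -> : enorm v = enorm (\sum_i v 0 i *: delta_mx 0 i).
  by rewrite -row_sum_delta.
have : forall s : seq 'I_d, enorm (\sum_(i <- s) v 0 i *: delta_mx 0 i) <= (size s)%:R * `|v|.
  elim=> [|i s ih]; first by rewrite big_nil enorm0 mul0r.
  rewrite big_cons (le_trans (ler_enormD _ _))//= -natr1 mulrDl mul1r addrC lerD//.
  have e1 : enorm (delta_mx 0 i : 'rV[R]_d) = 1.
    rewrite /enorm /dotv (bigD1 i)//= !mxE !eqxx mulr1 big1 ?addr0 ?sqrtr1// => j ji.
    by rewrite mxE (negPf ji) andbF mulr0.
  rewrite enormZ e1 mulr1 [leRHS]/Num.norm/= mx_normrE (bigD1 (0, i))//=.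
  by rewrite le_max lexx.
by move/(_ (index_enum _)); rewrite /index_enum -enumT size_enum_ord.
Qed.

Lemma elipschitz_continuous (c : R) (h : 'rV[R]_d -> R) :
  (forall x y, `|h x - h y| <= c * enorm (x - y)) -> continuous h.
Proof.
move=> hL x s /= /(nbhs_ballP (h x)) [e /= e0 es]; apply/nbhs_ballP.
(* The added 1 keeps the modulus positive even when [c] or [d] vanishes. *)
have k0 : 0 < `|c| * d%:R + 1 by rewrite ltr_wpDl// mulr_ge0.
exists (e / (`|c| * d%:R + 1)) => /=; first exact: divr_gt0.
move=> y; rewrite -ball_normE /= ltr_pdivlMr// => xy; apply/es.
rewrite -ball_normE /=; apply: le_lt_trans xy; rewrite (le_trans (hL _ _))//.
rewrite (le_trans (ler_wpM2r (enorm_ge0 _) (ler_norm c)))//.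
rewrite (le_trans (ler_wpM2l (normr_ge0 c) (enorm_le_norm _)))//.
by rewrite mulrDr mulr1 mulrA [leLHS]mulrC lerDl.
Qed.

Lemma enorm_continuous : continuous (@enorm R d).
Proof.
apply: (@elipschitz_continuous 1) => x y; rewrite mul1r ler_norml lerBlDr.
rewrite lerNl opprB lerBlDr; apply/andP; split.
  rewrite -{1}(subrK x y) (le_trans (ler_enormD _ _))//.
  by rewrite enormB lerD2l.
by rewrite -{1}(subrK y x) ler_enormD.
Qed.

End euclidean.

(** * Convexity of sets and functions, stated with real weights *)

Section convexity.
Context {R : realType} {d : nat}.
Implicit Types (x y : 'rV[R]_d) (X : set 'rV[R]_d).

Lemma convex_setP X : convex_set X <->
  forall x y (t : R), X x -> X y -> 0 <= t <= 1 -> X (t *: x + (1 - t) *: y).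
Proof.
split=> [cX x y t Xx Xy /andP[t0 t1]|cX x y t /set_mem Xx /set_mem Xy].
- have /mem_set Xx' := Xx; have /mem_set Xy' := Xy.
  by have /set_mem := cX _ _ (Itv01 t0 t1) Xx' Xy'.
- by apply/mem_set; apply: cX => //; rewrite ge0 le1.
Qed.

Lemma convex_functionP X (f : 'rV[R]_d -> R) : convex_function X f <->
  forall x y (t : R), X x -> X y -> 0 <= t <= 1 ->
    f (t *: x + (1 - t) *: y) <= t * f x + (1 - t) * f y.
Proof.
split=> [cf x y t Xx Xy /andP[t0 t1]|cf t x y /set_mem Xx /set_mem Xy].
- have /mem_set Xx' := Xx; have /mem_set Xy' := Xy.
  exact: (cf (Itv01 t0 t1) _ _ Xx' Xy').
- by apply: cf => //; rewrite ge0 le1.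
Qed.

End convexity.

(** * Borel measurability of vector-valued maps *)

Section borel.
Context {R : realType} {d : nat}.

Lemma open_rV_measurable (U : set 'rV[R]_d) : open U -> measurable U.
Proof. by move=> oU; exact: sub_sigma_algebra. Qed.

Lemma closed_rV_measurable (U : set 'rV[R]_d) : closed U -> measurable U.
Proof.
move=> cU; rewrite -(setCK U); apply: measurableC; apply: open_rV_measurable.
exact: closed_openC.
Qed.

Lemma continuous_rV_measurable (h : 'rV[R]_d -> R) :
  continuous h -> measurable_fun setT h.
Proof.
move=> /continuousP ch; apply: (measurability _ (RGenOpens.measurableE R)).
move=> _ [_ [a [b ->] <-]]; rewrite setTI; apply: open_rV_measurable.
exact/ch/interval_open.
Qed.

Lemma coord_measurable i : measurable_fun setT (fun v : 'rV[R]_d => v 0 i).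
Proof. by apply: continuous_rV_measurable; exact: coord_continuous. Qed.

Lemma elipschitz_measurable (c : R) (h : 'rV[R]_d -> R) :
  (forall x y, `|h x - h y| <= c * enorm (x - y)) -> measurable_fun setT h.
Proof. by move=> hL; exact: (continuous_rV_measurable (elipschitz_continuous hL)). Qed.

(* An open set is a countable union of cubes with rational centres. *)
Lemma measurable_fun_rVP dO (O : measurableType dO) (D : set O) (f : O -> 'rV[R]_d) :
  measurable_fun D f <-> forall i, measurable_fun D (fun w => f w 0 i).
Proof.
split=> [mf i|mf]; first exact: (measurableT_comp (coord_measurable i)).
move=> mD; have mf' : measurable_fun D f; last exact: mf'.
apply: (@measurability _ _ _ _ _ _ (@open 'rV[R]_d) erefl) => _ [U oU <-].
pose cube (p : 'rV[rat]_d * nat) : set 'rV[R]_d :=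
  [set v | forall i, `|ratr (p.1 0 i) - v 0 i| < p.2.+1%:R^-1].
have -> : D `&` f @^-1` U =
    \bigcup_(p : 'rV[rat]_d * nat)
      (if `[< cube p `<=` U >] then D `&` f @^-1` cube p else set0).
  apply/seteqP; split => [w [Dw /= Ufw]|w [p _]]; last first.
    by case: ifPn => // /asboolP pU [Dw /pU].
  have /nbhs_ballP[e /= e0 eU] := open_nbhs_nbhs (conj oU Ufw).
  have [k ke] : exists k : nat, k.+1%:R^-1 < e / 2.
    have e20 : 0 < e / 2 by exact: divr_gt0.
    have [k _ kP] := near_infty_natSinv_lt (PosNum e20).
    by exists k; apply: (kP k) => /=.
  have /choice[q qP] : forall i, exists q : rat, `|ratr q - f w 0 i| < k.+1%:R^-1 :> R.
    move=> i; have : f w 0 i - k.+1%:R^-1 < f w 0 i + k.+1%:R^-1.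
      by rewrite ltrD2l gtrN// invr_gt0.
    by move=> /rat_in_itvoo[q]; rewrite in_itv/= -ltr_distl; exists q.
  exists (\row_i q i, k) => //; rewrite ifT; last first.
    apply/asboolP => v /= vq; apply: eU; rewrite -ball_normE /=.
    rewrite [ltLHS]/Num.norm/= mx_normrE; apply/bigmax_ltP; split=> // -[i j] _ /=.
    (* Both [v] and [f w] are within [1 / k.+1 < e / 2] of the rational centre in each coordinate,
       so the cube lies in the ball of radius [e] around [f w]. *)
    rewrite (ord1 i) !mxE; have := vq j; rewrite !mxE /= => {}vq.
    rewrite (splitr e) -(subrK (ratr (q j)) (f w 0 j)) -addrA.
    rewrite (le_lt_trans (ler_normD _ _))// ltrD//; last exact: lt_trans ke.
    by rewrite distrC (lt_trans (qP j)).
  by split=> //= i; rewrite mxE.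
apply: countable_bigcupT_measurable => [|p]; first exact: countableP.
case: ifPn => // _.
have -> : D `&` f @^-1` cube p = D `&` \bigcap_i
    (D `&` (fun w => `|ratr (p.1 0 i) - f w 0 i|) @^-1` `]-oo, p.2.+1%:R^-1[%classic).
  apply/seteqP; split=> [w [Dw /= cw]|w [Dw cw]]; split=> //=.
    by move=> i _; split=> //=; rewrite in_itv/=.
  by move=> i; have [_ /=] := cw i I; rewrite in_itv.
apply: measurableI => //; apply: fin_bigcap_measurable => // i _.
have mg : measurable_fun D (fun w => `|ratr (p.1 0 i) - f w 0 i|).
  by apply: measurableT_comp => //; apply: measurable_funB => //; exact: mf.
exact: mg.
Qed.

Section operations.
Context {dO} {O : measurableType dO} (D : set O).
Implicit Types f g : O -> 'rV[R]_d.

Lemma measurable_dotv f g : measurable_fun D f -> measurable_fun D g ->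
  measurable_fun D (fun w => dotv (f w) (g w)).
Proof.
move=> /measurable_fun_rVP mf /measurable_fun_rVP mg.
by apply: measurable_sum => i; exact: measurable_funM.
Qed.

Lemma measurable_enorm f : measurable_fun D f ->
  measurable_fun D (fun w => enorm (f w)).
Proof.
exact: (measurableT_comp (continuous_rV_measurable (@enorm_continuous R d))).
Qed.

Lemma measurable_rVD f g : measurable_fun D f -> measurable_fun D g ->
  measurable_fun D (fun w => f w + g w).
Proof.
move=> /measurable_fun_rVP mf /measurable_fun_rVP mg; apply/measurable_fun_rVP => i.
by under eq_fun do rewrite mxE; exact: measurable_funD.
Qed.

Lemma measurable_rVZ (h : O -> R) f : measurable_fun D h -> measurable_fun D f ->
  measurable_fun D (fun w => h w *: f w).
Proof.
move=> mh /measurable_fun_rVP mf; apply/measurable_fun_rVP => i.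
by under eq_fun do rewrite mxE; exact: measurable_funM.
Qed.

Lemma measurable_rVB f g : measurable_fun D f -> measurable_fun D g ->
  measurable_fun D (fun w => f w - g w).
Proof.
move=> mf mg; apply: measurable_rVD => //.
by under eq_fun do rewrite -scaleN1r; exact: measurable_rVZ.
Qed.

Lemma measurable_rV_sum n (F : 'I_n -> O -> 'rV[R]_d) :
  (forall k, measurable_fun D (F k)) ->
  measurable_fun D (fun w => \sum_k F k w).
Proof.
move=> mF; apply/measurable_fun_rVP => i.
under eq_fun do rewrite summxE.
by apply: measurable_sum => k; have /measurable_fun_rVP := mF k.
Qed.

End operations.

End borel.

(** * Projection onto a bounded closed convex set *)

Section projection.
Context {R : realType} {d : nat} (K : set 'rV[R]_d).
Hypotheses (clK : closed K) (cvK : convex_set K) (K0 : K !=set0).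
Hypothesis bndK : exists M : R, forall x, K x -> enorm x <= M.

Lemma ebounded_compact : compact K.
Proof.
apply: bounded_closed_compact => //; have [M KM] := bndK.
exists M; split; first exact: num_real.
move=> N MN x Kx /=; rewrite [leLHS]/Num.norm/= mx_normrE.
apply/bigmax_leP; split=> [|[i j] _ /=].
  by rewrite (le_trans _ (ltW MN))// (le_trans _ (KM _ Kx))// enorm_ge0.
by rewrite (ord1 i) (le_trans (coord_le_enorm _ _))// (le_trans (KM _ Kx))// ltW.
Qed.

Lemma projection_exists y : exists p, K p /\ forall z, K z -> dotv (y - p) (z - p) <= 0.
Proof.
have cont : continuous (fun x : 'rV[R]_d => enorm (y - x)).
  apply: (@elipschitz_continuous _ _ 1) => a b; rewrite mul1r.
  rewrite ler_norml lerNl opprB !lerBlDr; apply/andP; split.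
    rewrite (_ : y - b = (a - b) + (y - a)); first exact: ler_enormD.
    by rewrite [RHS]addrC subrKA.
  rewrite (_ : y - a = (b - a) + (y - b)); last by rewrite [RHS]addrC subrKA.
  by rewrite (enormB a) ler_enormD.
have [p /set_mem Kp pmin] := compact_EVT_min K0 ebounded_compact (continuous_subspaceT cont).
exists p; split=> // z Kz.
rewrite leNgt; apply/negP => h.
set a := dotv (y - p) (z - p) in h; set b := dotv (z - p) (z - p).
have b0 : 0 <= b by exact: dotv_ge0.
(* Moving from [p] towards [z] by [t] changes the squared distance to [y] by [- t (2 a - t b)]. This
   [t] is at most 1, makes sense for [b = 0], and satisfies [t b <= a], so the distance would
   decrease. *)
pose t := a / (a + b).
have ab : 0 < a + b by rewrite ltr_pwDl.
have t0 : 0 < t by rewrite divr_gt0.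
have t1 : t <= 1 by rewrite ler_pdivrMr// mul1r lerDl.
have Kq : K (t *: z + (1 - t) *: p) by apply: (iffLR (convex_setP K)) => //; rewrite (ltW t0).
have /pmin := mem_set Kq.
rewrite -(@ler_pXn2r _ 2) ?nnegrE ?enorm_ge0// !enorm_sqr.
have -> : y - (t *: z + (1 - t) *: p) = (y - p) - t *: (z - p).
  by apply/rowP => i; rewrite !mxE; ring.
rewrite dotvBZ_sqr -/a -/b lerDl oppr_ge0 leNgt => /negP; apply.
rewrite mulr_gt0// mulr2n -addrA ltr_pwDl// subr_ge0.
rewrite /t mulrAC ler_pdivrMr//; nra.
Qed.

(** Adding the variational inequalities at [p x] and [p y] bounds [enorm (p x - p y) ^+ 2] by
    [dotv (x - y) (p x - p y)], and Cauchy-Schwarz gives nonexpansiveness. The coordinates of [p]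
    are then Lipschitz, hence measurable. *)
Lemma projection : exists p : 'rV[R]_d -> 'rV[R]_d,
  [/\ forall y, K (p y), forall z, K z -> p z = z,
      forall x y, enorm (p x - p y) <= enorm (x - y) & measurable_fun setT p].
Proof.
have [p pP] := choice projection_exists.
have nexp x y : enorm (p x - p y) <= enorm (x - y).
  have [Kx hx] := pP x; have [Ky hy] := pP y.
  have [->|n0] := eqVneq (enorm (p x - p y)) 0; first exact: enorm_ge0.
  have n0' : 0 < enorm (p x - p y) by rewrite lt_neqAle eq_sym n0 enorm_ge0.
  rewrite -(ler_pM2l n0') -expr2 enorm_sqr (le_trans _ (dotv_le _ _))//.
  have := hx _ Ky; have := hy _ Kx.
  rewrite !(dotvBl, dotvBr) (dotvC (p y) x) (dotvC (p y) y) (dotvC (p x) y) (dotvC (p x) x).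
  rewrite (dotvC (p y) (p x)); lra.
exists p; split=> // [y|z Kz|]; first by case: (pP y).
- have [_ /(_ _ Kz)] := pP z; rewrite -enorm_sqr => h.
  have /eqP : enorm (z - p z) ^+ 2 = 0 by apply/eqP; rewrite eq_le h sqr_ge0.
  by rewrite sqrf_eq0 => /eqP/enorm_eq0/eqP; rewrite subr_eq0 => /eqP.
- apply/measurable_fun_rVP => i; apply: (@elipschitz_measurable _ _ 1) => x y.
  rewrite mul1r; apply: le_trans (nexp x y).
  by have := coord_le_enorm (p x - p y) i; rewrite !mxE.
Qed.

End projection.

(** * Algorithms and the law of the samples *)

Lemma measurable_rcons d1 d2 (O : measurableType d1) (V : measurableType d2) (n : nat)
    (f : O -> n.-tuple V) (g : O -> V) :
  measurable_fun setT f -> measurable_fun setT g ->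
  measurable_fun setT (fun w => [tuple of rcons (f w) (g w)]).
Proof.
move=> mf mg; apply/measurable_fun_tnthP => i.
have [ilt|ige] := ltnP i n.
  rewrite (_ : _ \o _ = fun w => tnth (f w) (Ordinal ilt)).
    exact: (measurableT_comp (measurable_tnth _)).
  apply/funext => w /=; rewrite !(tnth_nth (g w)) nth_rcons size_tuple ilt//.
rewrite (_ : _ \o _ = g)//; apply/funext => w /=.
rewrite (tnth_nth (g w)) /= nth_rcons size_tuple ltnNge ige/=.
by rewrite eqn_leq ige -ltnS ltn_ord.
Qed.

Section first_order_algorithms.
Context {R : realType} {d : nat} (X : set 'rV[R]_d).
Hypotheses (clX : closed X) (X0 : X 0).

Section run.
Variables (T : nat) (alg : forall t : nat, t.-tuple 'rV[R]_d -> R -> 'rV[R]_d).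
Hypothesis algP : forall t, (0 < t <= T)%N -> (forall h u, X (@alg t h u)) /\
  measurable_fun setT
    (fun hu : t.-tuple 'rV[R]_d * measurableTypeR R => @alg t hu.1 hu.2).

Lemma sfo_iterate_domain t (h : t.-tuple 'rV[R]_d) u : (t <= T)%N ->
  X (sfo_iterate alg h u).
Proof.
move=> tT; rewrite /sfo_iterate; case: eqP => // /eqP t0.
by case: (@algP t); rewrite ?lt0n ?t0.
Qed.

Lemma measurable_sfo_iterate t : (t <= T)%N -> measurable_fun setT
  (fun hu : t.-tuple 'rV[R]_d * measurableTypeR R => sfo_iterate alg hu.1 hu.2).
Proof.
move=> tT; rewrite /sfo_iterate; have [t0|t0] := eqVneq t 0%N => //.
by case: (@algP t); rewrite ?lt0n ?t0.
Qed.

Variable I : so_instance X.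

(** Observed functions are truncated to [X] and [nth] has a default value, but the iterates stay in
    [X] and [t < T]. The algorithm therefore sees the true selected gradient. *)
Lemma sfo_history_observed (w : T.-tuple (so_space I)) u t (tT : (t < T)%N) :
  sfo_history alg (map (@observed R d X I) w) u t.+1 =
  let h := sfo_history alg (map (@observed R d X I) w) u t in
  [tuple of rcons h (so_grad I (sfo_iterate alg h u) (tnth w (Ordinal tT)))].
Proof.
apply/val_inj => /=; congr (rcons _ _).
set x := sfo_iterate _ _ _.
have Xx : X x by apply: sfo_iterate_domain; exact: ltnW.
rewrite (nth_map (tnth w (Ordinal tT))) ?size_tuple//= patchE mem_set//.
by rewrite [in RHS](tnth_nth (tnth w (Ordinal tT)))/=; congr so_grad.
Qed.

(** Induction on [t]: the new gradient is the jointly measurable selection on [X] times the sample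
    space, evaluated at a measurable iterate with values in [X]. Closedness of [X] makes that
    product measurable. *)
Lemma measurable_sfo_history t : (t <= T)%N -> measurable_fun setT
  (fun w : T.-tuple (so_space I) * measurableTypeR R =>
     sfo_history alg (map (@observed R d X I) w.1) w.2 t).
Proof.
elim: t => [_|t ih tT]; first by apply/measurable_fun_tnthP => -[].
have {}ih := ih (ltnW tT).
under eq_fun do rewrite (sfo_history_observed _ _ tT).
apply: measurable_rcons => //.
have mX : measurable (X `*` [set: so_space I]).
  by apply: measurableX => //; exact: closed_rV_measurable.
pose x (w : T.-tuple (so_space I) * measurableTypeR R) :=
  (sfo_iterate alg (sfo_history alg (map (@observed R d X I) w.1) w.2 t) w.2,
   tnth w.1 (Ordinal tT)).
apply: (@measurable_comp _ _ _ _ _ _ (X `*` [set: so_space I])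
  (fun p => so_grad I p.1 p.2) _ x) => //.
- by move=> _ [w _ <-]; split => //=; apply: sfo_iterate_domain; exact: ltnW.
- exact: so_grad_measurable.
- apply/measurable_fun_pairP; split.
    have m1 : measurable_fun setT (fun w : T.-tuple (so_space I) * measurableTypeR R =>
        (sfo_history alg (map (@observed R d X I) w.1) w.2 t, w.2)).
      by apply/measurable_fun_pairP; split => //; exact: measurable_snd.
    exact: (measurableT_comp (measurable_sfo_iterate (ltnW tT)) m1).
  exact: (measurableT_comp (measurable_tnth _)).
Qed.

End run.

Lemma algs_SFO_sub_SO T : @algs_SFO R d T X `<=` @algs_SO R d T X.
Proof.
move=> _ [alg [algP ->]]; split=> [z u|I _].
  exact: (sfo_iterate_domain algP).
rewrite /so_output /sfo_output.
have m1 : measurable_fun setT (fun w : T.-tuple (so_space I) * measurableTypeR R =>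
    (sfo_history alg (map (@observed R d X I) w.1) w.2 T, w.2)).
  apply/measurable_fun_pairP; split; last exact: measurable_snd.
  exact: (measurable_sfo_history algP).
exact: (measurableT_comp (measurable_sfo_iterate algP (leqnn T)) m1).
Qed.

End first_order_algorithms.

(** * Comparison principles for the minimax error *)

Section minimax.
Context {R : realType} {d T : nat} {X : set 'rV[R]_d}.
Implicit Types (err : so_alg R d T -> so_instance X -> \bar R).

Lemma minimax_err_le err algs (insts : so_instance X -> Prop) (alg : so_alg R d T) b :
  algs alg -> (forall I, insts I -> (err alg I <= b)%E) ->
  (minimax_err err algs insts <= b)%E.
Proof.
move=> Aalg h; apply: (@le_trans _ _ (ereal_sup [set e | exists2 I, insts I & e = err alg I])).
  by apply: ereal_inf_lbound; exists alg.
by apply: ge_ereal_sup => _ [I Iin ->]; exact: h.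
Qed.

Lemma le_minimax_err err algs (insts : so_instance X -> Prop) b :
  (forall alg, algs alg -> exists2 I, insts I & (b <= err alg I)%E) ->
  (b <= minimax_err err algs insts)%E.
Proof.
move=> h; apply: le_ereal_inf_tmp => _ [alg Aalg <-].
have [I Iin bI] := h _ Aalg; apply: le_trans bI _.
by apply: ereal_sup_ubound; exists I.
Qed.

(** Reduces the upper bounds for all four pairs of classes to one: first-order algorithms against
    the second-moment class. *)
Lemma minimax_err_mono err (algs algs' : set (so_alg R d T))
    (insts insts' : so_instance X -> Prop) :
  algs' `<=` algs -> (forall I, insts I -> insts' I) ->
  (minimax_err err algs insts <= minimax_err err algs' insts')%E.
Proof.
move=> sA sI; apply: le_ereal_inf_tmp => _ [alg Aalg <-].
apply: minimax_err_le (sA _ Aalg) _ => I Iin; apply: ereal_sup_ubound.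
by exists I => //; exact: sI.
Qed.

End minimax.

(** * Integration against the law of the samples *)

Section iid.
Context {R : realType} {dS} {S : measurableType dS} (P : probability S R).
Local Open Scope ereal_scope.

Lemma measurable_cons_pairT n : measurable_fun setT (@cons_pair S n).
Proof. exact: measurable_cons. Qed.

(** Tonelli splits off the first sample. Both the analysis of the descent and the change of measure
    are inductions that peel samples from the front. *)
Lemma iid_law_integralS n (g : n.+1.-tuple S -> \bar R) :
  measurable_fun setT g -> (forall w, 0 <= g w) ->
  \int[iid_law P n.+1]_w g w = \int[P]_s \int[iid_law P n]_w g (cons_pair (s, w)).
Proof.
move=> mg g0; rewrite /= ge0_integral_pushforward// fubini_tonelli1//.
  by apply: measurableT_comp => //; exact: measurable_cons_pairT.
by move=> x; exact: g0.
Qed.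

Lemma measurable_iid_integral n (g : n.+1.-tuple S -> \bar R) :
  measurable_fun setT g -> (forall w, 0 <= g w) ->
  measurable_fun setT (fun s => \int[iid_law P n]_w g (cons_pair (s, w))).
Proof.
move=> mg g0.
apply: (measurable_fun_fubini_tonelli_F (g \o @cons_pair S n)).
  by apply: measurableT_comp => //; exact: measurable_cons_pairT.
by move=> x; exact: g0.
Qed.

Lemma iid_law_integral0 (g : 0.-tuple S -> \bar R) :
  measurable_fun setT g -> \int[iid_law P 0]_w g w = g [tuple].
Proof. by move=> mg; rewrite integral_dirac//= diracT mul1e. Qed.

End iid.

Section run_law.
Context {R : realType} {d T : nat} {X : set 'rV[R]_d} (I : so_instance X).
Local Open Scope ereal_scope.

Lemma run_law_integral (g : T.-tuple (so_space I) * measurableTypeR R -> \bar R) :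
  measurable_fun setT g -> (forall w, 0 <= g w) ->
  \int[run_law T I]_w g w =
  \int[iid_law (so_law I) T]_w \int[uniform_prob (@ltr01 R)]_u g (w, u).
Proof. by move=> mg g0; rewrite fubini_tonelli1. Qed.

Lemma run_law_integral1 (g : T.-tuple (so_space I) -> \bar R) :
  measurable_fun setT g -> (forall w, 0 <= g w) ->
  \int[run_law T I]_w g w.1 = \int[iid_law (so_law I) T]_w g w.
Proof.
move=> mg g0; rewrite run_law_integral//; last exact: (measurableT_comp mg).
apply: eq_integral => w _ /=.
by rewrite integral_cst//= probability_setT mule1.
Qed.

End run_law.

(** * Upper bounds *)

Section real_integrable.
Context {R : realType} {dS} {S : measurableType dS} (P : probability S R).

Local Notation integrableR f := (P.-integrable setT (EFin \o f)).

Lemma integrableR_cst (a : R) : integrableR (fun _ : S => a).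
Proof. exact: finite_measure_integrable_cst. Qed.

Lemma integrableRD (f g : S -> R) : integrableR f -> integrableR g ->
  integrableR (fun s => f s + g s).
Proof. by move=> fi gi; apply: eq_integrable (integrableD _ fi gi). Qed.

Lemma integrableRZ (a : R) (f : S -> R) : integrableR f ->
  integrableR (fun s => a * f s).
Proof. by move=> fi; apply: eq_integrable (integrableZl _ a fi). Qed.

Lemma Rintegral_prob_cst (a : R) : \int[P]_s a = a.
Proof. by rewrite Rintegral_cst// [X in fine X]probability_setT mulr1. Qed.

Lemma le_integrableR (f g : S -> R) : measurable_fun setT f ->
  (forall s, `|f s| <= g s) -> integrableR g -> integrableR f.
Proof.
move=> mf fg; apply: le_integrable => //; first exact/measurable_EFinP.
by move=> s _ /=; rewrite lee_fin (le_trans (fg s))// ler_norm.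
Qed.

End real_integrable.

(** * The mean of a random gradient with bounded second moment *)

Section mean_gradient.
Context {R : realType} {d : nat} {dS} {S : measurableType dS} (P : probability S R).
Variables (g : S -> 'rV[R]_d) (L : R).
Hypotheses (mg : measurable_fun setT g) (L0 : 0 < L)
  (gL : (\int[P]_s (enorm (g s) ^+ 2)%:E <= (L ^+ 2)%:E)%E).

Local Notation integrableR f := (P.-integrable setT (EFin \o f)).

Lemma integrable_enorm_sqr : integrableR (fun s => enorm (g s) ^+ 2).
Proof.
apply/integrableP; split.
  by apply/measurable_EFinP/measurable_funX; exact: measurable_enorm.
rewrite (le_lt_trans _ (ltry (L ^+ 2)))//; apply: le_trans gL.
by under eq_integral do rewrite /= ger0_norm ?sqr_ge0//.
Qed.

Lemma Rintegral_enorm_sqr : \int[P]_s (enorm (g s) ^+ 2) <= L ^+ 2.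
Proof.
rewrite -lee_fin /Rintegral fineK//; exact: integrable_fin_num integrable_enorm_sqr.
Qed.

(** The square of [enorm v - L] is nonnegative. This controls first-order quantities by the second
    moment alone, with equality at [enorm v = L], so no constant is lost below. *)
Lemma enorm_le_quadratic (v : 'rV[R]_d) : enorm v <= 2^-1 * L + (2^-1 * L^-1) * enorm v ^+ 2.
Proof.
have : 0 <= (2^-1 * L^-1) * (enorm v - L) ^+ 2.
  by rewrite mulr_ge0 ?sqr_ge0// mulr_ge0// invr_ge0 ltW.
have -> : (2^-1 * L^-1) * (enorm v - L) ^+ 2 =
  2^-1 * L + (2^-1 * L^-1) * enorm v ^+ 2 - enorm v by field; rewrite gt_eqF.
by rewrite subr_ge0.
Qed.

Lemma integrable_dotv u : integrableR (fun s => dotv (g s) u).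
Proof.
apply: (@le_integrableR _ _ _ _ _
  (fun s => enorm u * (2^-1 * L + (2^-1 * L^-1) * enorm (g s) ^+ 2))).
- exact: measurable_dotv.
- move=> s; rewrite (le_trans (normr_dotv_le _ _))// mulrC.
  by rewrite ler_wpM2l ?enorm_ge0// enorm_le_quadratic.
- apply: integrableRZ; apply: integrableRD; first exact: integrableR_cst.
  by apply: integrableRZ; exact: integrable_enorm_sqr.
Qed.

Definition mean_grad : 'rV[R]_d := \row_i \int[P]_s (g s 0 i).

Lemma Rintegral_dotv u : \int[P]_s (dotv (g s) u) = dotv mean_grad u.
Proof.
have ig i : integrableR (fun s => g s 0 i).
  have := integrable_dotv (delta_mx 0 i); congr (integrable _ _ _).
  apply/funext => s /=; congr EFin.
  rewrite /dotv (bigD1 i)//= mxE !eqxx mulr1 big1 ?addr0// => j ji.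
  by rewrite mxE (negPf ji) andbF mulr0.
(* The induction over lists of coordinates carries integrability along, as additivity of the
   integral requires it. *)
suff H : forall r : seq 'I_d, integrableR (fun s => \sum_(i <- r) g s 0 i * u 0 i) /\
    \int[P]_s (\sum_(i <- r) g s 0 i * u 0 i) = \sum_(i <- r) mean_grad 0 i * u 0 i.
  by have [_] := H (index_enum _).
elim=> [|i r [ir eqr]].
  split; last by rewrite big_nil; under eq_Rintegral do rewrite big_nil; rewrite Rintegral_prob_cst.
  by under eq_fun do rewrite big_nil; exact: integrableR_cst.
have iu : integrableR (fun s => g s 0 i * u 0 i).
  by under eq_fun do rewrite mulrC; exact: integrableRZ.
split; first by under eq_fun do rewrite big_cons; exact: integrableRD.
under eq_Rintegral do rewrite big_cons.
by rewrite RintegralD// eqr big_cons RintegralZr// mxE.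
Qed.

Lemma integrable_affine_quadratic a b c u :
  integrableR (fun s => a + b * dotv (g s) u + c * enorm (g s) ^+ 2).
Proof.
apply: integrableRD; last by apply: integrableRZ; exact: integrable_enorm_sqr.
apply: integrableRD; first exact: integrableR_cst.
by apply: integrableRZ; exact: integrable_dotv.
Qed.

Lemma Rintegral_affine_quadratic_le a b c u : 0 <= c ->
  \int[P]_s (a + b * dotv (g s) u + c * enorm (g s) ^+ 2) <=
  a + b * dotv mean_grad u + c * L ^+ 2.
Proof.
move=> c0; have ic := integrableR_cst P a; have id := integrable_dotv u.
have iq := integrable_enorm_sqr.
rewrite RintegralD//; last 2 first.
- by apply: integrableRD => //; exact: integrableRZ.
- exact: integrableRZ.
rewrite RintegralD//; last exact: integrableRZ.
rewrite Rintegral_prob_cst !RintegralZl// Rintegral_dotv.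
by rewrite lerD2l ler_wpM2l// Rintegral_enorm_sqr.
Qed.

(** With [u] the mean, [enorm u ^+ 2] is the integral of [dotv (g s) u], hence at most [enorm u]
    times the integral of [enorm (g s)]. The quadratic bound makes the latter at most
    [L / 2 + L / 2]. *)
Lemma enorm_mean_grad : enorm mean_grad <= L.
Proof.
have [->|G0] := eqVneq (enorm mean_grad) 0; first exact: ltW.
have G0' : 0 < enorm mean_grad by rewrite lt_neqAle eq_sym G0 enorm_ge0.
rewrite -(ler_pM2l G0') -{1}expr2 enorm_sqr -Rintegral_dotv.
set u := mean_grad.
have c0 : 0 <= enorm u * (2^-1 * L^-1) by rewrite mulr_ge0 ?enorm_ge0// mulr_ge0// invr_ge0 ltW.
have := Rintegral_affine_quadratic_le (enorm u * (2^-1 * L)) 0 u c0.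
rewrite mul0r addr0 => h; apply: le_trans (le_trans h _).
  apply: le_Rintegral => //; [exact: integrable_dotv|exact: integrable_affine_quadratic|].
  move=> s _; rewrite mul0r addr0 (le_trans (dotv_le _ _))// mulrC -mulrA -mulrDr.
  by rewrite ler_wpM2l ?enorm_ge0// enorm_le_quadratic.
rewrite -mulrA -mulrDr ler_wpM2l ?enorm_ge0// le_eqVlt; apply/orP; left; apply/eqP.
by field; rewrite gt_eqF.
Qed.

End mean_gradient.

Section convex_average.
Context {R : realType} {d : nat}.

(** The average of [n.+2] points is the convex combination of the last point, with weight
    [1 / n.+2], and the average of the others. *)
Lemma convex_set_average (K : set 'rV[R]_d) n (x : 'I_n.+1 -> 'rV[R]_d) :
  convex_set K -> (forall k, K (x k)) -> K (n.+1%:R^-1 *: \sum_k x k).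
Proof.
move=> /convex_setP cK; elim: n x => [|n ih] x Kx.
  by rewrite big_ord1 invr1 scale1r.
rewrite big_ord_recr/= scalerDr addrC.
have -> : n.+2%:R^-1 *: \sum_(i < n.+1) x (widen_ord (leqnSn n.+1) i) =
  (1 - n.+2%:R^-1) *: (n.+1%:R^-1 *: \sum_(i < n.+1) x (widen_ord (leqnSn n.+1) i)).
  rewrite scalerA; congr (_ *: _).
  rewrite -[n.+2%:R]natr1; have : 0 < n.+1%:R :> R by rewrite ltr0n.
  move: n.+1%:R => m m0; field; rewrite !gt_eqF// addr_gt0//.
apply: cK => //; first exact: ih.
by rewrite invr_ge0 ler0n invf_le1 ?ltr0n// ler1n.
Qed.

End convex_average.

(** * Regularity of the objective under the second-moment condition *)

Section smlip.
Context {R : realType} {d : nat} (X : set 'rV[R]_d) (L : R) (I : so_instance X).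
Hypotheses (clX : closed X) (L0 : 0 < L) (cvI : so_convex I).
Hypothesis smI : forall x, X x ->
  ('E_(so_law I)[fun s => (enorm (so_grad I x s) ^+ 2)%R] <= (L ^+ 2)%:E)%E.

Local Notation F := (so_objective I).
Local Notation P := (so_law I).

Lemma so_objectiveE x : F x = \int[P]_s (so_f I x s).
Proof. by rewrite /so_objective unlock. Qed.

Lemma measurable_so_grad {dO} {O : measurableType dO} (x : O -> 'rV[R]_d)
    (s : O -> so_space I) :
  measurable_fun setT x -> measurable_fun setT s -> (forall w, X (x w)) ->
  measurable_fun setT (fun w => so_grad I (x w) (s w)).
Proof.
move=> mx ms Xx.
apply: (@measurable_comp _ _ _ _ _ _ (X `*` [set: so_space I])
  (fun p => so_grad I p.1 p.2) _ (fun w => (x w, s w))) => //.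
- by apply: measurableX => //; exact: closed_rV_measurable.
- by move=> _ [w _ <-]; split => //=.
- exact: so_grad_measurable.
- by apply/measurable_fun_pairP.
Qed.

Lemma measurable_so_grad_sample x : X x -> measurable_fun setT (so_grad I x).
Proof. by move=> Xx; exact: measurable_so_grad. Qed.

Lemma so_grad_second_moment x : X x ->
  (\int[P]_s (enorm (so_grad I x s) ^+ 2)%:E <= (L ^+ 2)%:E)%E.
Proof. by move=> /smI; rewrite unlock. Qed.

(** Integrate the subgradient inequality over the sample: the mean of the selected gradients is a
    subgradient of the mean. Every property of the objective used below comes from this. *)
Lemma so_objective_subgradient x : X x ->
  subgradient X F x (mean_grad P (so_grad I x)).
Proof.
move=> Xx y Xy; rewrite !so_objectiveE.
have mg := measurable_so_grad_sample Xx; have gL := so_grad_second_moment Xx.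
have idot := integrable_dotv mg L0 gL (y - x).
rewrite -(Rintegral_dotv mg L0 gL) -RintegralD//; last exact: so_f_integrable.
apply: le_Rintegral => //; [|exact: so_f_integrable|].
  by apply: integrableRD => //; exact: so_f_integrable.
by move=> s _; exact: so_grad_subgradient.
Qed.

(** The sample functions may have no common Lipschitz constant here, but the mean gradient has norm
    at most [L]. The subgradient inequality at [x] and at [y] gives the two directions. *)
Lemma so_objective_lipschitz : elipschitz_on X L F.
Proof.
have h x y : X x -> X y -> F x - F y <= L * enorm (x - y).
  move=> Xx Xy; have := so_objective_subgradient Xx Xy.
  have mg := measurable_so_grad_sample Xx; have gL := so_grad_second_moment Xx.
  have := dotv_le (mean_grad P (so_grad I x)) (x - y).
  have := enorm_mean_grad mg L0 gL.
  rewrite -(opprB x y) dotvNr => GL h1 h2.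
  have := ler_wpM2r (enorm_ge0 (x - y)) GL; lra.
move=> x y Xx Xy; rewrite ler_norml lerNl opprB h// andbT.
by rewrite enormB h.
Qed.

(** Jensen's inequality, from the subgradient at the average [a]: the linear terms in [x k - a] sum
    to 0. *)
Lemma so_objective_average n (x : 'I_n.+1 -> 'rV[R]_d) :
  convex_set X -> (forall k, X (x k)) ->
  F (n.+1%:R^-1 *: \sum_k x k) <= n.+1%:R^-1 * \sum_k F (x k).
Proof.
move=> cvX Xx; set a := _ *: _; have Xa : X a by exact: convex_set_average.
rewrite ler_pdivlMl ?ltr0n//.
pose G := mean_grad P (so_grad I a).
have : \sum_k (F a + dotv G (x k - a)) <= \sum_k F (x k).
  by apply: ler_sum => k _; exact: so_objective_subgradient.
rewrite big_split/= sumr_const card_ord -[F a *+ _]mulr_natl.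
suff -> : \sum_k dotv G (x k - a) = 0 by rewrite addr0.
have -> : \sum_k dotv G (x k - a) = dotv G (\sum_k (x k - a)).
  elim/big_rec2 : _ => [|k u v _ ->]; first by rewrite dotvC dot0v.
  by rewrite [RHS]dotvDr.
rewrite sumrB sumr_const card_ord -scaler_nat /a scalerA mulfV ?pnatr_eq0//.
by rewrite scale1r subrr dotvC dot0v.
Qed.

End smlip.

(** * Exponential inequalities for one step *)

Section exponential_bounds.
Context {R : realType}.

(** From [1 - z <= expR (- z)], the exponential is at most [1 / (1 - z)]. Multiplying the right-hand
    side by [1 - z] gives [1 + z ^ 2 (1 - 2 z)], at least 1 for every [z <= 1 / 2], however
    negative. *)
Lemma expR_le_quadratic (z : R) : z <= 1 / 2 -> expR z <= 1 + z + 2 * z ^+ 2.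
Proof.
move=> z2; have z1 : 0 < 1 - z by lra.
have : expR z <= (1 - z)^-1.
  rewrite -[expR z]invrK lef_pV2 ?posrE ?invr_gt0 ?expR_gt0// -expRN.
  by rewrite expR_ge1Dx.
move=> h; apply: le_trans h _.
by rewrite -div1r ler_pdivrMr//; nra.
Qed.

(* [Y] stands for [<g, x - x*>] and [v] for [|g|]; the clipped terms are dominated by
   an affine function of [Y] and [v ^ 2], which can be integrated exactly. *)
Lemma expR_clipped_step (th et la D A Y v : R) :
  0 < th -> 0 < et -> 0 < la -> 0 <= D -> 0 <= A -> 0 <= v -> `|Y| <= D * v ->
  th * (A + D * la + et / 2 * la ^+ 2) <= 1 / 2 ->
  expR (th * (A + (if v <= la then - Y + et / 2 * v ^+ 2 else 0))) <=
  (1 + th * A + 6 * th ^+ 2 * A ^+ 2) + (- th) * Y +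
  (th * D / la + th * et / 2 + 6 * th ^+ 2 * (D ^+ 2 + et ^+ 2 * la ^+ 2 / 4)) * v ^+ 2.
Proof.
move=> th0 et0 la0 D0 A0 v0 YD small.
have Y1 : Y <= D * v by exact: le_trans (ler_norm _) YD.
have Y2 : - Y <= D * v by apply: le_trans (ler_norm _) _; rewrite normrN.
have tA : th * A <= 1 / 2.
  apply: le_trans small; rewrite ler_wpM2l ?(ltW th0)// -addrA lerDl.
  by rewrite addr_ge0// mulr_ge0 ?(ltW la0)// ?sqr_ge0// divr_ge0// ltW.
have t2 : 0 <= th ^+ 2 by exact: sqr_ge0.
have q1 : 0 <= th * D / la * v ^+ 2.
  by rewrite mulr_ge0 ?sqr_ge0// divr_ge0 ?(ltW la0)// mulr_ge0// ltW.
have q2 : 0 <= th * et / 2 * v ^+ 2.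
  by rewrite mulr_ge0 ?sqr_ge0// divr_ge0// mulr_ge0// ltW.
have q3 : 0 <= 6 * th ^+ 2 * (D ^+ 2 + et ^+ 2 * la ^+ 2 / 4) * v ^+ 2.
  have e0 : 0 <= D ^+ 2 + et ^+ 2 * la ^+ 2 / 4.
    by apply: addr_ge0; rewrite ?sqr_ge0// divr_ge0// mulr_ge0 ?sqr_ge0.
  by apply: mulr_ge0; rewrite ?sqr_ge0//; apply: mulr_ge0 => //; exact: mulr_ge0.
rewrite !mulrDl; case: ifPn => [vla|]; last first.
  rewrite -ltNge => lav; rewrite addr0.
  apply: le_trans (expR_le_quadratic tA) _.
  (* On a truncated gradient the increment is 0, yet the bound contains [- th * Y]. The truncation
     bias term pays for it: [Y <= D v <= D v ^ 2 / la]. *)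
  have tYv : th * Y <= th * D / la * v ^+ 2.
    apply: (@le_trans _ _ (th * (D * v))); first by rewrite ler_wpM2l// ltW.
    rewrite expr2 -!mulrA ler_wpM2l ?(ltW th0)// ler_wpM2l// mulrA.
    by rewrite ler_peMl// mulrC ler_pdivlMr// mul1r ltW.
  have : 0 <= th ^+ 2 * A ^+ 2 by rewrite mulr_ge0 ?sqr_ge0.
  rewrite exprMn; nra.
set z := th * _.
have v2 : v ^+ 2 <= la ^+ 2 by rewrite ler_pXn2r ?nnegrE// ltW.
have Y22 : Y ^+ 2 <= D ^+ 2 * v ^+ 2.
  by rewrite -exprMn -[Y ^+ 2]real_normK ?num_real// ler_pXn2r ?nnegrE// mulr_ge0.
set w := et / 2 * v ^+ 2.
have w0 : 0 <= w by rewrite mulr_ge0 ?sqr_ge0// divr_ge0// ltW.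
(* Truncation turns the fourth power of [v] into a second power, the highest moment available. *)
have w2 : w ^+ 2 <= et ^+ 2 * la ^+ 2 / 4 * v ^+ 2.
  rewrite /w exprMn [X in X <= _](_ : _ = et ^+ 2 / 4 * v ^+ 2 * v ^+ 2); last by field.
  rewrite [leRHS](_ : _ = et ^+ 2 / 4 * v ^+ 2 * la ^+ 2); last by field.
  by rewrite ler_wpM2l// mulr_ge0 ?sqr_ge0// divr_ge0 ?sqr_ge0.
have z1 : z <= 1 / 2.
  apply: le_trans small; rewrite ler_wpM2l ?(ltW th0)// -addrA lerD2l lerD//.
    by apply: le_trans Y2 _; rewrite ler_wpM2l.
  by rewrite ler_wpM2l// divr_ge0// ltW.
apply: le_trans (expR_le_quadratic z1) _.
(* The square of a sum of three terms is at most three times the sum of squares; with the factor 2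
   of the quadratic bound this is the constant 6. *)
have z2 : z ^+ 2 <= th ^+ 2 * (3 * (A ^+ 2 + D ^+ 2 * v ^+ 2 + et ^+ 2 * la ^+ 2 / 4 * v ^+ 2)).
  rewrite /z exprMn ler_wpM2l// -/w.
  apply: (@le_trans _ _ (3 * (A ^+ 2 + Y ^+ 2 + w ^+ 2))); last first.
    by rewrite ler_wpM2l// !lerD.
  have := sqr_ge0 (A + Y); have := sqr_ge0 (A - w); have := sqr_ge0 (Y + w); nra.
have ez : z = th * A - th * Y + th * et / 2 * v ^+ 2 by rewrite /z; field.
lra.
Qed.

End exponential_bounds.

(** * One step of truncated projected descent *)

Section clipped_sgd.
Context {R : realType} {d : nat}.
Variables (p : 'rV[R]_d -> 'rV[R]_d) (eta la : R).

Definition truncate (v : 'rV[R]_d) : 'rV[R]_d := if enorm v <= la then v else 0.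

Definition sgd_step (x v : 'rV[R]_d) : 'rV[R]_d := p (x - eta *: truncate v).

Lemma measurable_sgd_step {dO} {O : measurableType dO} (x v : O -> 'rV[R]_d) :
  measurable_fun setT p -> measurable_fun setT x -> measurable_fun setT v ->
  measurable_fun setT (fun w => sgd_step (x w) (v w)).
Proof.
move=> mp mx mv; apply: (measurableT_comp mp); apply: measurable_rVB => //.
apply: measurable_rVZ => //; apply: measurable_fun_ifT => //.
by apply: measurable_fun_ler => //; exact: measurable_enorm.
Qed.

(** As [z] is fixed by the nonexpansive map [p], projecting does not increase the distance to [z];
    the rest is the expansion of a square. *)
Lemma sgd_step_enorm_sqr x v z :
  (forall x y, enorm (p x - p y) <= enorm (x - y)) -> p z = z ->
  enorm (sgd_step x v - z) ^+ 2 <= enorm (x - z) ^+ 2 +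
    (if enorm v <= la then
       - (2 * eta * dotv v (x - z)) + eta ^+ 2 * enorm v ^+ 2 else 0).
Proof.
move=> pL pz; apply: (@le_trans _ _ (enorm (x - z - eta *: truncate v) ^+ 2)).
  rewrite ler_pXn2r ?nnegrE ?enorm_ge0// -{1}pz (le_trans (pL _ _))//.
  by rewrite addrAC.
rewrite enorm_sqr dotvBZ_sqr -!enorm_sqr /truncate; case: ifPn => _.
  by rewrite (dotvC (x - z)) le_eqVlt; apply/orP; left; apply/eqP; ring.
by rewrite dotvC dot0v enorm0 expr0n/= mulr0 mul0rn subrr mulr0 subr0 addr0.
Qed.

End clipped_sgd.

Section one_step.
Context {R : realType} {d : nat} (X : set 'rV[R]_d) (L B r : R) (I : so_instance X).
Hypotheses (clX : closed X) (L0 : 0 < L) (B0 : 0 < B) (r0 : 0 < r) (r1 : r <= 1).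
Hypothesis cvI : so_convex I.
Hypothesis smI : forall x, X x ->
  ('E_(so_law I)[fun s => (enorm (so_grad I x s) ^+ 2)%R] <= (L ^+ 2)%:E)%E.
Variable p : 'rV[R]_d -> 'rV[R]_d.
Hypotheses (pL : forall x y, enorm (p x - p y) <= enorm (x - y))
  (mp : measurable_fun setT p).

Local Notation F := (so_objective I).
Local Notation P := (so_law I).
Local Notation la := (L / r).
Local Notation eta := (B * r / L).
Local Notation th := (r / (20 * L * B)).

(** With this scaling an untruncated step with gradient [v] raises the potential by at most [- dotv
    v (x - z) + eta / 2 * enorm v ^+ 2]. *)
Definition sgd_potential (z x : 'rV[R]_d) : R := enorm (x - z) ^+ 2 / (2 * eta).

(** After integration the linear term is [- th * dotv G (x - z)], and by convexity it cancels the
    excess [th * A]. Only second-order terms remain, and the choice of [th], [eta], [la] makes them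
    at most [r ^+ 2]. *)
Lemma sgd_step_exp_moment (x z : 'rV[R]_d) : X x -> X z -> p z = z ->
  F z <= F x -> enorm (x - z) <= 4 * B ->
  (\int[P]_s (expR (th * ((F x - F z) +
      sgd_potential z (sgd_step p eta la x (so_grad I x s)))))%:E
   <= (expR (th * sgd_potential z x + r ^+ 2))%:E)%E.
Proof.
move=> Xx Xz pz Fzx xz.
have eta0 : 0 < eta by rewrite divr_gt0// mulr_gt0.
have la0 : 0 < la by rewrite divr_gt0.
have LB0 : 0 < 20 * L * B by rewrite !mulr_gt0.
have th0 : 0 < th by rewrite divr_gt0.
set A := F x - F z; set D := 4 * B.
have D0 : 0 <= D by rewrite mulr_ge0// ltW.
have A0 : 0 <= A by rewrite subr_ge0.
have mg := measurable_so_grad_sample (I := I) clX Xx.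
have gL := so_grad_second_moment smI Xx.
pose G := mean_grad P (so_grad I x).
have AG : A <= dotv G (x - z).
  have := so_objective_subgradient clX L0 cvI smI Xx Xz.
  by rewrite -/G -(opprB x z) dotvNr /A; lra.
have AD : A <= 4 * (L * B).
  have := so_objective_lipschitz clX L0 cvI smI Xx Xz.
  rewrite ger0_norm// -/A => /le_trans; apply.
  by rewrite mulrCA ler_wpM2l// ltW.
have thA : th * A <= r / 5.
  rewrite (_ : r / 5 = th * (4 * (L * B))) ?ler_wpM2l ?(ltW th0)//.
  by field; rewrite !gt_eqF.
pose a := 1 + th * A + 6 * th ^+ 2 * A ^+ 2.
pose c := th * D / la + th * eta / 2 + 6 * th ^+ 2 * (D ^+ 2 + eta ^+ 2 * la ^+ 2 / 4).
have c0 : 0 <= c.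
  have th' := ltW th0; have eta' := ltW eta0; have la' := ltW la0.
  have c1 : 0 <= th * D / la by apply: divr_ge0 => //; exact: mulr_ge0.
  have c2 : 0 <= th * eta / 2 by apply: divr_ge0 => //; exact: mulr_ge0.
  have c3 : 0 <= eta ^+ 2 * la ^+ 2 / 4.
    by apply: divr_ge0 => //; apply: mulr_ge0; exact: sqr_ge0.
  apply: addr_ge0; first exact: addr_ge0.
  apply: mulr_ge0; first by apply: mulr_ge0 => //; exact: sqr_ge0.
  by apply: addr_ge0 => //; exact: sqr_ge0.
have cL : c * L ^+ 2 = (4 / 20 + 1 / 40 + 6 * (16 + 1 / 4) / 400) * r ^+ 2.
  by rewrite /c /D; field; rewrite !gt_eqF.
have pw s : expR (th * (A + sgd_potential z (sgd_step p eta la x (so_grad I x s)))) <=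
    expR (th * sgd_potential z x) *
    (a + (- th) * dotv (so_grad I x s) (x - z) + c * enorm (so_grad I x s) ^+ 2).
  set v := so_grad I x s; set Y := dotv v (x - z).
  (* The three parts are at most 1/5, 4/20 and 1/40; the first uses [r <= 1]. *)
  have small : th * (A + D * la + eta / 2 * la ^+ 2) <= 1 / 2.
    rewrite mulrDr mulrDr.
    have -> : th * (D * la) = 4 / 20 by rewrite /D; field; rewrite !gt_eqF.
    have -> : th * (eta / 2 * la ^+ 2) = 1 / 40 by field; rewrite !gt_eqF.
    by move: thA r1; lra.
  have YD : `|Y| <= D * enorm v.
    rewrite (le_trans (normr_dotv_le _ _))// mulrC ler_wpM2r ?enorm_ge0//.
  apply: le_trans (ler_wpM2l (expR_ge0 _)
    (expR_clipped_step th0 eta0 la0 D0 A0 (enorm_ge0 v) YD small)).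
  rewrite -expRD ler_expR -mulrDr ler_wpM2l ?(ltW th0)// addrCA lerD2l.
  have eta2 : 0 < 2 * eta by exact: mulr_gt0.
  rewrite /sgd_potential ler_pdivrMr// mulrDl divfK ?gt_eqF//.
  apply: le_trans (sgd_step_enorm_sqr _ _ _ _ pL pz) _; rewrite lerD2l.
  case: ifPn => _; last by rewrite mul0r.
  by rewrite -/Y le_eqVlt; apply/orP; left; apply/eqP; field; rewrite !gt_eqF.
have iq := integrable_affine_quadratic mg L0 gL a (- th) c (x - z).
set E := expR (th * sgd_potential z x) in pw *.
apply: (@le_trans _ _ (\int[P]_s (E * (a + (- th) * dotv (so_grad I x s) (x - z) +
    c * enorm (so_grad I x s) ^+ 2))%:E)%E).
  apply: ge0_le_integral => //=.
  - apply/measurable_EFinP; apply: measurableT_comp => //.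
    apply: measurable_funM => //; apply: measurable_funD => //.
    apply: measurable_funM => //; apply: measurable_funX; apply: measurable_enorm.
    by apply: measurable_rVB => //; exact: measurable_sgd_step.
  - apply/measurable_EFinP; apply: measurable_funM => //.
    by apply/measurable_EFinP; exact: measurable_int iq.
  - by move=> s _; rewrite lee_fin pw.
have iEq := integrableRZ E iq.
rewrite -(fineK (integrable_fin_num _ iEq))// lee_fin.
rewrite [leLHS](_ : _ = E * \int[P]_s (a + (- th) * dotv (so_grad I x s) (x - z) +
    c * enorm (so_grad I x s) ^+ 2)); last by rewrite -RintegralZl.
rewrite expRD ler_wpM2l ?expR_ge0//.
apply: le_trans (Rintegral_affine_quadratic_le mg L0 gL _ _ _ c0) _.
rewrite -/G cL.
apply: le_trans (expR_ge1Dx _).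
(* The coefficients of [r ^+ 2] are 6/25 from [A ^+ 2] and 4/20 + 1/40 + 6 (16 + 1/4) / 400 from
   [c]; their sum is below 1. *)
have A2 : th ^+ 2 * A ^+ 2 <= r ^+ 2 / 25.
  rewrite -exprMn (_ : _ / 25 = (r / 5) ^+ 2); last by field.
  have th' : 0 <= th * A by apply: mulr_ge0 => //; exact: ltW.
  by rewrite ler_pXn2r ?nnegrE//; apply: divr_ge0 => //; exact: ltW.
have : th * A <= th * dotv G (x - z) by rewrite ler_wpM2l// ltW.
have : 0 <= r ^+ 2 by exact: sqr_ge0.
rewrite /a; lra.
Qed.

End one_step.

(** * The algorithm and its trajectory *)

Section sgd_algorithm.
Context {R : realType} {d : nat}.
Variables (p : 'rV[R]_d -> 'rV[R]_d) (eta la : R) (K : set 'rV[R]_d).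
Hypotheses (mp : measurable_fun setT p) (pK : forall x, K (p x)) (K0 : K 0)
  (cvK : convex_set K).

Definition sgd_last (h : seq 'rV[R]_d) : 'rV[R]_d :=
  foldl (sgd_step p eta la) 0 h.

Definition sgd_average (T : nat) (h : seq 'rV[R]_d) : 'rV[R]_d :=
  T%:R^-1 *: \sum_(k < T) sgd_last (take k h).

(** The output of a first-order method is its iterate number [T], so that iterate is defined as the
    average of the descent iterates [0, ..., T - 1]. Before time [T] the descent iterate is
    recomputed from the gradient history. *)
Definition sgd_alg (T t : nat) (h : t.-tuple 'rV[R]_d) (u : R) : 'rV[R]_d :=
  if (t < T)%N then sgd_last h else sgd_average T h.

Lemma sgd_last_domain h : K (sgd_last h).
Proof. by elim/last_ind: h => // h v _; rewrite /sgd_last foldl_rcons; exact: pK. Qed.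

Lemma sgd_alg_domain T t h u : (0 < T)%N -> K (@sgd_alg T t h u).
Proof.
move=> T0; rewrite /sgd_alg; case: ifPn => _; first exact: sgd_last_domain.
case: T T0 => // T _; apply: convex_set_average => // k; exact: sgd_last_domain.
Qed.

Lemma measurable_sgd_last t k : (k <= t)%N ->
  measurable_fun setT (fun h : t.-tuple 'rV[R]_d => sgd_last (take k h)).
Proof.
elim: k => [_|k ih kt].
  by under eq_fun do rewrite take0; exact: measurable_cst.
have e (h : t.-tuple 'rV[R]_d) : sgd_last (take k.+1 h) =
    sgd_step p eta la (sgd_last (take k h)) (tnth h (Ordinal kt)).
  by rewrite (take_nth 0) ?size_tuple// /sgd_last foldl_rcons (tnth_nth 0).
under eq_fun do rewrite e; apply: measurable_sgd_step => //; first by apply: ih; exact: ltnW.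
exact: measurable_tnth.
Qed.

Lemma measurable_sgd_alg T t : (t <= T)%N -> measurable_fun setT
  (fun hu : t.-tuple 'rV[R]_d * measurableTypeR R => @sgd_alg T t hu.1 hu.2).
Proof.
move=> tT; rewrite /sgd_alg; case: ltnP => [_|Tt].
  have m : measurable_fun setT (fun h : t.-tuple 'rV[R]_d => sgd_last h).
    have := measurable_sgd_last (leqnn t); congr measurable_fun.
    by apply/funext => h; rewrite take_oversize// size_tuple.
  exact: (measurableT_comp m).
apply: measurable_rVZ => //; apply: measurable_rV_sum => k.
have kt : (k <= t)%N by rewrite (leq_trans (ltnW (ltn_ord k))).
exact: (measurableT_comp (measurable_sgd_last kt)).
Qed.

Lemma sgd_alg_SFO (X : set 'rV[R]_d) T : (0 < T)%N -> K `<=` X ->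
  @algs_SFO R d T X (sfo_output (sgd_alg T) (T := T)).
Proof.
move=> T0 KX; exists (sgd_alg T); split=> // t /andP[t0 tT]; split.
  by move=> h u; apply: KX; exact: sgd_alg_domain.
exact: measurable_sgd_alg.
Qed.

End sgd_algorithm.

Section sgd_run.
Context {R : realType} {d : nat} (X : set 'rV[R]_d) (L B r : R) (I : so_instance X).
Hypotheses (clX : closed X) (L0 : 0 < L) (B0 : 0 < B) (r0 : 0 < r) (r1 : r <= 1).
Hypothesis cvI : so_convex I.
Hypothesis smI : forall x, X x ->
  ('E_(so_law I)[fun s => (enorm (so_grad I x s) ^+ 2)%R] <= (L ^+ 2)%:E)%E.
Variables (K : set 'rV[R]_d) (p : 'rV[R]_d -> 'rV[R]_d).
Hypotheses (pL : forall x y, enorm (p x - p y) <= enorm (x - y))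
  (mp : measurable_fun setT p) (pK : forall x, K (p x))
  (pid : forall x, K x -> p x = x) (KX : K `<=` X)
  (KB : forall x, K x -> enorm x <= 2 * B) (K0 : K 0) (cvK : convex_set K).
Variable z : 'rV[R]_d.
Hypotheses (Kz : K z) (zmin : forall y, X y -> so_objective I z <= so_objective I y).

Local Notation F := (so_objective I).
Local Notation P := (so_law I).
Local Notation la := (L / r).
Local Notation eta := (B * r / L).
Local Notation th := (r / (20 * L * B)).
Local Notation S := (so_space I).

(** Evaluating at [p x] keeps the argument in [X], which makes these maps measurable on the whole
    space; on [K], where the iterates live, [p] is the identity. *)
Let gp (x : 'rV[R]_d) (s : S) : 'rV[R]_d := so_grad I (p x) s.
Let step (x : 'rV[R]_d) (s : S) : 'rV[R]_d := sgd_step p eta la x (gp x s).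
Let excess (x : 'rV[R]_d) : R := F (p x) - F z.

(** Recursion on the first sample, with the starting point as an argument, matches the way [iid_law]
    is built. *)
Fixpoint regret (x : 'rV[R]_d) (w : seq S) : R :=
  if w is s :: w' then excess x + regret (step x s) w' else 0.

Lemma regretE x w : regret x w = \sum_(k < size w) excess (foldl step x (take k w)).
Proof.
elim: w x => [|s w ih] x; first by rewrite big_ord0.
by rewrite big_ord_recl/= ih.
Qed.

Lemma measurable_projected_objective : measurable_fun setT (fun x => F (p x)).
Proof.
apply: (@elipschitz_measurable _ _ L) => x y.
rewrite (le_trans (so_objective_lipschitz clX L0 cvI smI (KX (pK _)) (KX (pK _))))//.
by rewrite ler_wpM2l// ltW.
Qed.

Lemma measurable_regret n :
  measurable_fun setT (fun xw : 'rV[R]_d * n.-tuple S => regret xw.1 xw.2).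
Proof.
elim: n => [|n ih].
  rewrite (_ : (fun _ => _) = cst 0)//; apply/funext => -[x w] /=.
  by rewrite (tuple0 w).
have m0 : measurable_fun setT (fun xw : 'rV[R]_d * n.+1.-tuple S => thead xw.2).
  exact: (measurableT_comp (measurable_tnth ord0)).
have m1 : measurable_fun setT
    (fun xw : 'rV[R]_d * n.+1.-tuple S => [tuple of behead xw.2]).
  exact: (measurableT_comp (@measurable_behead _ _ _)).
have m2 : measurable_fun setT
    (fun xw : 'rV[R]_d * n.+1.-tuple S => step xw.1 (thead xw.2)).
  apply: measurable_sgd_step => //; apply: measurable_so_grad => //.
    exact: (measurableT_comp mp).
  by move=> w; exact/KX.
rewrite (_ : (fun _ => _) = (fun xw : 'rV[R]_d * n.+1.-tuple S => excess xw.1 +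
    regret (step xw.1 (thead xw.2)) [tuple of behead xw.2])).
  apply: measurable_funD.
    apply: measurable_funB => //.
    exact: (measurableT_comp measurable_projected_objective).
  apply: (measurableT_comp (f := fun xw : 'rV[R]_d * n.-tuple S => regret xw.1 xw.2)
    (g := fun xw : 'rV[R]_d * n.+1.-tuple S =>
      (step xw.1 (thead xw.2), [tuple of behead xw.2]))) => //.
  exact/measurable_fun_pairP.
by apply/funext => -[x w] /=; rewrite {1}(tuple_eta w).
Qed.

Lemma measurable_regret_from x n :
  measurable_fun setT (fun w : n.-tuple S => regret x w).
Proof.
apply: (measurableT_comp (@measurable_regret n) (g := fun w : n.-tuple S => (x, w))).
exact: measurable_pair1.
Qed.

(** Induction for all starting points at once. Given the first sample [s], the induction hypothesis
    at [step x s] bounds the inner integral by an exponential of the new potential, and the one-step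
    bound integrates that over [s] at the cost of one more [r ^+ 2]. *)
Lemma regret_exp_moment n x : K x ->
  (\int[iid_law P n]_w (expR (th * regret x w))%:E <=
   (expR (th * sgd_potential L B r z x + n%:R * r ^+ 2))%:E)%E.
Proof.
have th0 : 0 < th by rewrite divr_gt0// !mulr_gt0.
have mexp k y : measurable_fun setT
    (fun w : k.-tuple S => (expR (th * regret y w))%:E).
  apply/measurable_EFinP; apply: measurableT_comp => //.
  by apply: measurable_funM => //; exact: measurable_regret_from.
elim: n x => [|n ih] x Kx.
  rewrite iid_law_integral0//= lee_fin mulr0 expR0 mul0r addr0.
  rewrite -[leLHS]expR0 ler_expR mulr_ge0 ?(ltW th0)//.
  by rewrite divr_ge0 ?sqr_ge0// mulr_ge0// divr_ge0 ?mulr_ge0// ltW.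
rewrite iid_law_integralS//.
have xz : enorm (x - z) <= 4 * B.
  rewrite (le_trans (ler_enormD _ _))// enormN.
  by have := KB Kx; have := KB Kz; lra.
have := sgd_step_exp_moment clX L0 B0 r0 r1 cvI smI pL mp
  (KX Kx) (KX Kz) (pid Kz) (zmin (KX Kx)) xz.
set f := (fun s => (expR (th * (F x - F z + _)))%:E) => hf.
have mf : measurable_fun setT f.
  apply/measurable_EFinP; apply: measurableT_comp => //.
  apply: measurable_funM => //; apply: measurable_funD => //.
  apply: measurable_funM => //; apply: measurable_funX; apply: measurable_enorm.
  apply: measurable_rVB => //; apply: measurable_sgd_step => //.
  by apply: measurable_so_grad_sample => //; exact: KX.
apply: (@le_trans _ _ (\int[P]_s ((expR (n%:R * r ^+ 2))%:E * f s))%E); last first.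
  rewrite ge0_integralZl_EFin ?expR_ge0//; last by move=> s _; rewrite lee_fin expR_ge0.
  have -> : th * sgd_potential L B r z x + n.+1%:R * r ^+ 2 =
    n%:R * r ^+ 2 + (th * sgd_potential L B r z x + r ^+ 2) by rewrite -natr1; ring.
  rewrite [in leRHS]expRD EFinM.
  by rewrite lee_wpmul2l// lee_fin expR_ge0.
apply: ge0_le_integral => //=.
- by move=> s _; apply: integral_ge0 => w _; rewrite lee_fin expR_ge0.
- apply: (measurable_iid_integral P (mexp n.+1 x)) => w.
  by rewrite lee_fin expR_ge0.
- apply: emeasurable_funM => //.
- move=> s _; under eq_integral do rewrite mulrDr expRD EFinM.
  rewrite ge0_integralZl_EFin ?expR_ge0//; last exact: mexp.
  apply: (@le_trans _ _ ((expR (th * excess x))%:E *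
      (expR (th * sgd_potential L B r z (step x s) + n%:R * r ^+ 2))%:E)%E).
    by rewrite lee_wpmul2l ?lee_fin ?expR_ge0//; apply: ih; exact: pK.
  rewrite /f /excess /step /gp pid// -!EFinM lee_fin -!expRD ler_expR.
  by rewrite le_eqVlt; apply/orP; left; apply/eqP; ring.
Qed.

Section output.
Variable T : nat.
Hypothesis T0 : (0 < T)%N.
Let alg := sgd_alg p eta la T.
Let obs := @observed R d X I.

(** The second conjunct says that histories extend one another, so the final average, computed from
    the last history, really involves the earlier iterates. *)
Lemma sgd_history_prefix (w : T.-tuple S) u t : (t <= T)%N ->
  let h := sfo_history alg (map obs w) u in
  sgd_last p eta la (h t) = foldl step 0 (take t w) /\
  forall k, (k <= t)%N -> take k (h t) = h k :> seq _.
Proof.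
have algX k : (0 < k <= T)%N -> (forall h u, X (@alg k h u)) /\
    measurable_fun setT
      (fun hu : k.-tuple 'rV[R]_d * measurableTypeR R => @alg k hu.1 hu.2).
  move=> /andP[k0 kT]; split; last exact: measurable_sgd_alg.
  by move=> h v; apply: KX; exact: sgd_alg_domain.
elim: t => [_|t ih tT] h.
  by split=> [|k]; [rewrite take0|rewrite leqn0 => /eqP->].
have [ih1 ih2] := ih (ltnW tT).
have ht : h t.+1 = rcons (h t) (so_grad I (sgd_last p eta la (h t)) (tnth w (Ordinal tT))) :> seq _.
  have X0 : X 0 by exact: KX.
  rewrite /h (sfo_history_observed X0 algX)/=; congr rcons.
  congr so_grad; rewrite /sfo_iterate /alg /sgd_alg tT.
  (* At time 0 [sfo_iterate] returns the imposed start 0, which is also [sgd_last] of the empty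
     history. *)
  by case: eqP => // t0; rewrite -/alg; move: ih1; rewrite [in take _ _]t0 take0.
split.
  rewrite ht (take_nth (tnth w (Ordinal tT))) ?size_tuple//.
  rewrite /sgd_last !foldl_rcons -ih1 -/(sgd_last p eta la _).
  rewrite [in LHS](tnth_nth (tnth w (Ordinal tT)))/= /step /gp pid//.
  by apply: sgd_last_domain.
move=> k; rewrite leq_eqVlt => /orP[/eqP->|]; first by rewrite take_oversize// size_tuple.
rewrite ltnS => kt; rewrite ht -cats1 takel_cat ?size_tuple//.
exact: ih2.
Qed.

Lemma sgd_outputE (w : T.-tuple S * measurableTypeR R) :
  @so_output R d T X (sfo_output alg (T := T)) I w =
  T%:R^-1 *: \sum_(k < T) foldl step 0 (take k w.1).
Proof.
have hp := fun t => @sgd_history_prefix w.1 w.2 t.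
rewrite /so_output /sfo_output /sfo_iterate gtn_eqF// /alg /sgd_alg ltnn.
congr (_ *: _); apply: eq_bigr => k _; have kT := ltnW (ltn_ord k).
have [_ /(_ _ kT) ->] := hp _ (leqnn T).
by have [-> _] := hp _ kT.
Qed.

Lemma foldl_step_domain (w : seq S) : K (foldl step 0 w).
Proof. by elim/last_ind: w => // w s _; rewrite foldl_rcons; exact: pK. Qed.

Lemma sgd_output_domain w : K (@so_output R d T X (sfo_output alg (T := T)) I w).
Proof.
rewrite sgd_outputE; case: T T0 w => // n _ w.
by apply: convex_set_average => // k; exact: foldl_step_domain.
Qed.

(** The objective is controlled on [X] only, so it is replaced by its composition with [p], which
    agrees with it on the outputs. *)
Lemma measurable_sgd_output : convex_set X ->
  measurable_fun setT (fun w => F (@so_output R d T X (sfo_output alg (T := T)) I w)).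
Proof.
move=> cvX; have [_ /(_ I cvI) mo] : @algs_SO R d T X (sfo_output alg (T := T)).
  by apply: algs_SFO_sub_SO => //; [exact: KX|exact: (sgd_alg_SFO _ _ mp pK)].
under eq_fun do rewrite -(pid (sgd_output_domain _)).
exact: (measurableT_comp measurable_projected_objective).
Qed.

Lemma sgd_output_exp_moment : convex_set X ->
  (\int[run_law T I]_w
     (expR (th * (T%:R * (F (@so_output R d T X (sfo_output alg (T := T)) I w) - F z))))%:E
   <= (expR (1 / 10 + T%:R * r ^+ 2))%:E)%E.
Proof.
move=> cvX; have th0 : 0 < th by rewrite divr_gt0// !mulr_gt0.
have mreg : measurable_fun setT (fun w : T.-tuple S => (expR (th * regret 0 w))%:E).
  apply/measurable_EFinP; apply: measurableT_comp => //.
  by apply: measurable_funM => //; exact: measurable_regret_from.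
apply: (@le_trans _ _ (\int[run_law T I]_w (expR (th * regret 0 w.1))%:E)%E).
  apply: ge0_le_integral => //=.
  - apply/measurable_EFinP; apply: measurableT_comp => //.
    apply: measurable_funM => //; apply: measurable_funM => //.
    by apply: measurable_funB => //; exact: measurable_sgd_output.
  - exact: (measurableT_comp mreg).
  - move=> w _; rewrite lee_fin ler_expR ler_wpM2l ?(ltW th0)// sgd_outputE.
    rewrite regretE size_tuple.
    have -> : \sum_(k < T) excess (foldl step 0 (take k w.1)) =
        \sum_(k < T) (F (foldl step 0 (take k w.1)) - F z).
      by apply: eq_bigr => k _; rewrite /excess pid//; exact: foldl_step_domain.
    rewrite sumrB sumr_const card_ord -[F z *+ _]mulr_natl mulrBr lerD2r.
    rewrite mulrC -ler_pdivlMr ?ltr0n// mulrC.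
    case: T T0 w => // n _ w; apply: (so_objective_average clX L0 cvI smI) => // k.
    by apply: KX; exact: foldl_step_domain.
rewrite (run_law_integral1 mreg)//.
apply: le_trans (regret_exp_moment T K0) _; rewrite lee_fin ler_expR lerD2r.
(* The initial potential is at most [(2 B) ^ 2 / (2 eta)]; times [th] this is 1/10. *)
have : enorm (0 - z) ^+ 2 <= (2 * B) ^+ 2.
  by rewrite sub0r enormN ler_pXn2r ?nnegrE ?enorm_ge0 ?mulr_ge0 ?(ltW B0)//; exact: KB.
move=> /(ler_wpM2l (_ : 0 <= th / (2 * eta))) h.
rewrite /sgd_potential mulrCA mulrC.
have -> : 1 / 10 = th / (2 * eta) * (2 * B) ^+ 2 by field; rewrite !gt_eqF.
by apply: h; rewrite ltW// divr_gt0// mulr_gt0// divr_gt0// mulr_gt0.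
Qed.

End output.

End sgd_run.

(** * From an exponential moment to the mean and the quantile *)

Section exponential_tail.
Context {R : realType} {dO} {O : measurableType dO} (Pr : probability O R).
Variables (Y : O -> R) (m k a : R).
Hypotheses (mY : measurable_fun setT Y) (mleY : forall w, m <= Y w) (k0 : 0 < k).
Hypothesis expY : (\int[Pr]_w (expR (k * (Y w - m)))%:E <= (expR a)%:E)%E.

Let mexp : measurable_fun setT (fun w => expR (k * (Y w - m))).
Proof.
apply: measurableT_comp => //; apply: measurable_funM => //.
exact: measurable_funB.
Qed.

(** Pointwise [k y <= expR (k y)]; since [Y - m] is nonnegative the same bound yields its
    integrability. *)
Lemma expectation_exp_moment_le : ('E_Pr[Y] - m%:E <= (expR a / k)%:E)%E.
Proof.
have mG : measurable_fun setT (fun w => (Y w - m)%:E).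
  by apply/measurable_EFinP; exact: measurable_funB.
have iG : (\int[Pr]_w (Y w - m)%:E <= (expR a / k)%:E)%E.
  apply: (@le_trans _ _ (\int[Pr]_w ((k^-1)%:E * (expR (k * (Y w - m)))%:E))%E).
    apply: ge0_le_integral => //=.
    - by move=> w _; rewrite lee_fin subr_ge0.
    - by apply: emeasurable_funM => //; exact/measurable_EFinP.
    - move=> w _; rewrite -EFinM lee_fin ler_pdivlMl//.
      by rewrite (le_trans _ (expR_ge1Dx _))// lerDr.
  rewrite ge0_integralZl_EFin ?invr_ge0 ?(ltW k0)//; last first.
    exact/measurable_EFinP.
  by rewrite mulrC EFinM lee_wpmul2l// lee_fin invr_ge0 ltW.
have intG : Pr.-integrable setT (EFin \o (fun w => Y w - m)).
  apply/integrableP; split => //; apply: le_lt_trans (ltry (expR a / k)).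
  apply: le_trans iG; rewrite le_eqVlt; apply/orP; left; apply/eqP.
  by apply: eq_integral => w _ /=; rewrite ger0_norm// subr_ge0.
rewrite unlock (_ : (fun w => (Y w)%:E) = (fun w => ((Y w - m) + m)%:E)); last first.
  by apply/funext => w; rewrite subrK.
have im := integrableR_cst Pr m.
under eq_integral do rewrite EFinD.
rewrite integralD// integral_cst//= probability_setT mule1.
by rewrite addeK.
Qed.

Lemma quantile_exp_moment_le (del : R) : 0 < del ->
  (quantile Pr (1 - del) Y - m%:E <= ((a + ln (1 / del)) / k)%:E)%E.
Proof.
(* The level [u] solves [expR (a - k u) = del], so Markov's inequality gives exceedance probability
   at most [del]. *)
move=> del0; set u := _ / k; rewrite leeBlDr// -EFinD.
apply: ereal_inf_lbound; exists (u + m) => //=.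
pose A := [set w | ((expR (k * u))%:E <= `|(expR (k * (Y w - m)))%:E|)%E].
have mA : measurable A.
  rewrite -[A]setTI; apply: emeasurable_fun_c_infty => //.
  by apply: measurableT_comp => //; exact/measurable_EFinP.
have : ((expR (k * u))%:E * Pr A <= (expR a)%:E)%E.
  apply: le_trans expY; have := le_integral_abse Pr measurableT
    (g := fun w => (expR (k * (Y w - m)))%:E) (a := expR (k * u)).
  rewrite setTI => /(_ _ (expR_gt0 _)) h; apply: le_trans (h _) _.
    exact/measurable_EFinP.
  rewrite le_eqVlt; apply/orP; left; apply/eqP; apply: eq_integral => w _.
  by rewrite gee0_abs// lee_fin expR_ge0.
rewrite -lee_pdivlMl ?expR_gt0// -EFinM -expRN -expRD.
have -> : - (k * u) + a = - ln (1 / del) by rewrite /u; field; rewrite gt_eqF.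
rewrite div1r lnV// opprK lnK ?posrE// => PA.
apply: (@le_trans _ _ (Pr (~` A))).
  rewrite probability_setC// EFinB leeB//.
apply: le_measure; rewrite ?inE//; first exact: measurableC.
  rewrite -[X in measurable X]setTI; apply: measurable_fun_le => //.
move=> w /negP; rewrite gee0_abs ?lee_fin ?expR_ge0// ler_expR ler_pM2l// -ltNge.
by move=> h /=; rewrite -lerBlDr ltW.
Qed.

End exponential_tail.

(** * The upper rates *)

Section upper_bound.
Context {R : realType} {d : nat} (X : set 'rV[R]_d) (L B : R).
Hypotheses (clX : closed X) (cvX : convex_set X) (X0 : X 0) (L0 : 0 < L) (B0 : 0 < B).

Lemma instances_LipW (I : so_instance X) : instances_Lip L B I -> instances_SMLip L B I.
Proof.
case=> cvI _ gL aB; split=> // x Xx; rewrite -(expectation_cst (so_law I)) unlock.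
have mn : measurable_fun setT (fun s => (enorm (so_grad I x s) ^+ 2)%R).
  by apply: measurable_funX; apply: measurable_enorm; exact: measurable_so_grad_sample.
apply: ge0_le_integral => //=.
- by move=> s _; rewrite lee_fin sqr_ge0.
- exact/measurable_EFinP.
- by move=> s _; rewrite lee_fin ler_pXn2r ?nnegrE ?enorm_ge0 ?gL// ltW.
Qed.

(** The norm of the set of minimizers is an infimum; relaxing [B] to [2 * B] provides an actual
    minimizer without discussing attainment. This is why the iterates are confined to radius
    [2 * B]. *)
Lemma SMLip_minimizer (I : so_instance X) : instances_SMLip L B I ->
  exists z, [/\ X z, enorm z <= 2 * B,
    forall y, X y -> so_objective I z <= so_objective I y &
    so_inf I = (so_objective I z)%:E].
Proof.
case=> _ _ aB; have : (set_enorm (so_argmin I) < (2 * B)%:E)%E.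
  by apply: le_lt_trans aB _; rewrite lte_fin ltr_pMl// ltr1n.
move=> /ereal_inf_lt[_ [z [Xz zmin] <-]]; rewrite lte_fin => zB.
exists z; split => //; first exact: ltW.
apply/eqP; rewrite eq_le; apply/andP; split.
  by apply: ereal_inf_lbound; exists z.
by apply: le_ereal_inf_tmp => _ [y Xy <-]; rewrite lee_fin zmin.
Qed.

Let K := X `&` [set x | enorm x <= 2 * B].

Lemma domain_ball_convex : convex_set K.
Proof.
apply/convex_setP => x y t [Xx xB] [Xy yB] t01; split.
  exact: (iffLR (convex_setP X)).
have /andP[t0 t1] := t01.
rewrite /= (le_trans (ler_enormD _ _))// !enormZ !ger0_norm ?subr_ge0//.
have t1' : 0 <= 1 - t by rewrite subr_ge0.
by have := ler_wpM2l t0 xB; have := ler_wpM2l t1' yB; lra.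
Qed.

Lemma domain_ball_projection : exists p : 'rV[R]_d -> 'rV[R]_d,
  [/\ forall y, K (p y), forall z, K z -> p z = z,
      forall x y, enorm (p x - p y) <= enorm (x - y) & measurable_fun setT p].
Proof.
apply: projection.
- apply: closedI => //.
  have -> : [set x | enorm x <= 2 * B] = @enorm R d @^-1` [set y | y <= 2 * B] by [].
  by apply: closed_comp => [x _|]; [exact: enorm_continuous|exact: closed_le].
- exact: domain_ball_convex.
- by exists 0; split; rewrite //= enorm0 mulr_ge0// ltW.
- by exists (2 * B) => x [].
Qed.

(** The choice [r = sqrt (l / T)] makes the accumulated cost [T r ^ 2] equal to [l], and [l <= T]
    ensures [r <= 1]. One algorithm, fixed before the instance, serves the whole class. *)
Lemma sgd_upper (T : nat) (l : R) : (0 < T)%N -> 0 < l -> l <= T%:R ->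
  exists2 alg, @algs_SFO R d T X alg & forall I, instances_SMLip L B I ->
  exists m, [/\ so_inf I = m%:E,
    measurable_fun setT (fun w => so_objective I (@so_output R d T X alg I w)),
    forall w, m <= so_objective I (@so_output R d T X alg I w) &
    (\int[run_law T I]_w (expR (T%:R * Num.sqrt (l / T%:R) / (20 * L * B) *
       (so_objective I (@so_output R d T X alg I w) - m)))%:E
     <= (expR (1 / 10 + l))%:E)%E].
Proof.
move=> T0 l0 lT; set r := Num.sqrt _.
have T0' : 0 < T%:R :> R by rewrite ltr0n.
have r0 : 0 < r by rewrite sqrtr_gt0 divr_gt0.
have r1 : r <= 1 by rewrite -sqrtr1 ler_sqrt// ler_pdivrMr// mul1r.
have r2 : T%:R * r ^+ 2 = l.
  by rewrite sqr_sqrtr ?divr_ge0 ?(ltW l0)// mulrC divfK// gt_eqF.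
have [p [pK pid pL mp]] := domain_ball_projection.
have K0 : K 0 by split; rewrite //= enorm0 mulr_ge0// ltW.
have cvK := domain_ball_convex.
have KX : K `<=` X by move=> x [].
have KB x : K x -> enorm x <= 2 * B by case.
exists (sfo_output (sgd_alg p (B * r / L) (L / r) T) (T := T)).
  exact: (sgd_alg_SFO _ _ mp pK).
move=> I SI; have [z [Xz zB zmin infz]] := SMLip_minimizer SI.
have [cvI smI _] := SI; have Kz : K z by split.
exists (so_objective I z); split=> //.
- exact: (measurable_sgd_output B r clX L0 cvI smI pL mp pK pid KX K0 cvK T0 cvX).
- move=> w; apply: zmin; apply: (KX).
  exact: (sgd_output_domain L B r mp pK pid KX K0 cvK T0 w).
- have := sgd_output_exp_moment clX L0 B0 r0 r1 cvI smI pL mp pK pid KX KB K0 cvK Kz zmin T0 cvX.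
  rewrite r2; congr (_ <= _)%E; apply: eq_integral => w _; congr (expR _)%:E.
  by rewrite -/(so_objective _ _); ring.
Qed.

End upper_bound.

Section upper_rates.
Context {R : realType} {d : nat} (X : set 'rV[R]_d) (L B : R).
Hypotheses (clX : closed X) (cvX : convex_set X) (X0 : X 0) (L0 : 0 < L) (B0 : 0 < B).

Lemma minimax_err_mean_le (T : nat) : (0 < T)%N ->
  (minimax_err (@err_mean R d T X) (@algs_SFO R d T X) (@instances_SMLip R d X L B)
   <= (20 * expR 2 * (L * B / Num.sqrt T%:R))%:E)%E.
Proof.
move=> T0; have T0' : 0 < T%:R :> R by rewrite ltr0n.
have T1 : 1 <= T%:R :> R by rewrite ler1n.
have [alg Aalg algP] := sgd_upper clX cvX X0 L0 B0 T0 ltr01 T1.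
apply: minimax_err_le Aalg _ => I /algP[m [infm mF mle expF]].
rewrite /err_mean infm.
set k := T%:R * _ / _ in expF.
have s0 : 0 < Num.sqrt T%:R :> R by rewrite sqrtr_gt0.
have sT : Num.sqrt T%:R ^+ 2 = T%:R :> R by rewrite sqr_sqrtr// ltW.
have kE : k = Num.sqrt T%:R / (20 * L * B).
  rewrite /k div1r sqrtrV ?ler0n// -{1}sT expr2 mulfK// gt_eqF//.
have k0 : 0 < k by rewrite kE divr_gt0// !mulr_gt0.
apply: le_trans (expectation_exp_moment_le mF mle k0 expF) _.
rewrite lee_fin kE.
have -> : expR (1 / 10 + 1) / (Num.sqrt T%:R / (20 * L * B)) =
  20 * (L * B / Num.sqrt T%:R) * expR (1 / 10 + 1) by field; rewrite !gt_eqF.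
rewrite [leRHS]mulrAC ler_wpM2l ?ler_expR; [by []| |by lra].
by rewrite mulr_ge0// divr_ge0 ?mulr_ge0// ltW.
Qed.

Lemma sfo_constant T : @algs_SFO R d T X (sfo_output (fun _ _ _ => 0) (T := T)).
Proof. by exists (fun _ _ _ => 0); split. Qed.

Lemma minimax_err_quantile_le (T : nat) (del : R) : (0 < T)%N -> 0 < del -> del < 1 / 2 ->
  (minimax_err (@err_quantile R d T X del) (@algs_SFO R d T X) (@instances_SMLip R d X L B)
   <= (120 * (L * B / Num.sqrt (1 + T%:R / ln (1 / del))))%:E)%E.
Proof.
move=> T0 del0 del2; have T0' : 0 < T%:R :> R by rewrite ltr0n.
set l := ln (1 / del).
(* By the quadratic bound [expR (1 / 2) <= 2], and [2 < 1 / del]. *)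
have l2 : 1 / 2 <= l.
  rewrite -ler_expR lnK ?posrE ?divr_gt0//.
  apply: le_trans (expR_le_quadratic (lexx _)) _.
  rewrite ler_pdivlMr//; lra.
have l0 : 0 < l by apply: lt_le_trans l2.
have Tl0 : 0 < T%:R / l by rewrite divr_gt0.
set q := Num.sqrt (1 + T%:R / l).
have q0 : 0 < q by rewrite sqrtr_gt0 addr_gt0.
have q2 : q ^+ 2 = 1 + T%:R / l by rewrite sqr_sqrtr// ltW// addr_gt0.
have LB0 : 0 < L * B by rewrite mulr_gt0.
have [lT|Tl] := leP l T%:R.
- have [alg Aalg algP] := sgd_upper clX cvX X0 L0 B0 T0 l0 lT.
  apply: minimax_err_le Aalg _ => I /algP[m [infm mF mle expF]].
  rewrite /err_quantile infm.
  set r := Num.sqrt _ in expF; set k := T%:R * _ / _ in expF.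
  have r0 : 0 < r by rewrite sqrtr_gt0 divr_gt0.
  have r2 : r ^+ 2 = l / T%:R by rewrite sqr_sqrtr// divr_ge0// ltW.
  have k0 : 0 < k by rewrite divr_gt0 ?mulr_gt0.
  apply: le_trans (quantile_exp_moment_le mF k0 expF del0) _.
  rewrite lee_fin -/l ler_pdivrMr//.
  have rq : r * q <= 2.
    rewrite -(@ler_pXn2r _ 2) ?nnegrE ?mulr_ge0 ?(ltW r0) ?(ltW q0)//.
    have e : l / T%:R * (1 + T%:R / l) = l / T%:R + 1 by field; rewrite !gt_eqF.
    rewrite exprMn r2 q2 e.
    have : l / T%:R <= 1 by rewrite ler_pdivrMr// mul1r.
    by rewrite expr2; lra.
  (* Since [r q <= 2] and [T r ^ 2 = l], the right-hand side is at least [3 l]; the left-hand side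
     is [2 l + 1 / 10], and [l >= 1 / 2]. *)
  have -> : 120 * (L * B / q) * k = 6 * (T%:R * r / q) by rewrite /k; field; rewrite !gt_eqF.
  have : T%:R * r ^+ 2 = l by rewrite r2 mulrC divfK// gt_eqF.
  move=> Tr; have : l / 2 <= T%:R * r / q.
    rewrite ler_pdivlMr// -Tr.
    rewrite [leLHS](_ : _ = T%:R * r * (r * q / 2)); last by field.
    by rewrite ler_piMr ?mulr_ge0 ?(ltW r0)// ler_pdivrMr// mul1r.
  lra.
(* With fewer than [l] samples [q <= 2], so the rate is of order [L B]; the constant output 0
   already has error at most [2 L B] by the Lipschitz bound. *)
- apply: (minimax_err_le (sfo_constant T)) => I SI.
  have [z [Xz zB zmin infz]] := SMLip_minimizer B0 SI; have [cvI smI _] := SI.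
  rewrite /err_quantile infz leeBlDr// -EFinD.
  have out0 w : so_output (sfo_output (fun _ _ _ => 0) (T := T)) w = 0 :> 'rV[R]_d.
    by rewrite /so_output /sfo_output /sfo_iterate; case: ifP.
  apply: (@le_trans _ _ (so_objective I 0)%:E).
    apply: ereal_inf_lbound; exists (so_objective I 0) => //=.
    rewrite (_ : [set w | _] = setT) ?probability_setT ?lee_fin ?gerBl ?(ltW del0)//.
    by apply/seteqP; split => // w _ /=; rewrite out0.
  rewrite lee_fin -lerBlDr.
  have := so_objective_lipschitz clX L0 cvI smI X0 Xz.
  rewrite ger0_norm ?subr_ge0 ?zmin// => /le_trans; apply.
  rewrite sub0r enormN (le_trans (ler_wpM2l (ltW L0) zB))//.
  have q4 : q <= 2.
    rewrite -(@ler_pXn2r _ 2) ?nnegrE ?(ltW q0)// q2.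
    have : T%:R / l <= 1 by rewrite ler_pdivrMr// mul1r ltW.
    by rewrite expr2; lra.
  have : L * B / 2 <= L * B / q by rewrite ler_pM2l// lef_pV2 ?posrE.
  lra.
Qed.

End upper_rates.

(** * Lower bounds *)

Section probable_gap.
Context {R : realType} {dO} {O : measurableType dO} (Pr : probability O R).
Variables (Y : O -> R) (m a del : R).
Hypotheses (mY : measurable_fun setT Y) (a0 : 0 < a).
Hypothesis gapY : (del%:E < Pr [set w | (m + a <= Y w)%R])%E.

Let measurable_gap : measurable [set w | m + a <= Y w].
Proof. by rewrite -[X in measurable X]setTI; exact: measurable_fun_le. Qed.

(** For [y] below [m + a] the event [Y <= y] avoids the gap event, so its probability is below
    [1 - del] and [y] does not compete in the quantile. *)
Lemma quantile_gap_ge : (a%:E <= quantile Pr (1 - del) Y - m%:E)%E.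
Proof.
rewrite leeBrDr// -EFinD; apply: le_ereal_inf_tmp => _ [y /= yP <-].
rewrite lee_fin leNgt; apply/negP => ym; move: yP; apply/negP; rewrite -ltNge.
apply: (@le_lt_trans _ _ (Pr (~` [set w | m + a <= Y w]))).
  apply: le_measure; rewrite ?inE.
  - by rewrite -[X in measurable X]setTI; exact: measurable_fun_le.
  - exact: measurableC.
  - by move=> w /= Yy; apply/negP; rewrite -ltNge (le_lt_trans Yy)// addrC.
have Pfin : Pr [set w | m + a <= Y w] \is a fin_num by exact: fin_num_measure.
by rewrite probability_setC// -(fineK Pfin) -EFinB lte_fin ltrD2l ltrN2 -lte_fin fineK.
Qed.

(** [Y] dominates [m] plus [a] times the indicator of the gap event. As [m >= 0], all integrands are
    nonnegative and the bound also covers an infinite expectation. *)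
Lemma expectation_gap_ge : 0 <= m -> (forall w, m <= Y w) ->
  ((a * del)%:E <= 'E_Pr[Y] - m%:E)%E.
Proof.
move=> m0 mleY; rewrite leeBrDr// unlock.
pose f w : R := m + a * \1_[set w | m + a <= Y w] w.
apply: (@le_trans _ _ (\int[Pr]_w (f w)%:E)%E); last first.
  apply: ge0_le_integral => //=.
  - by move=> w _; rewrite lee_fin addr_ge0// mulr_ge0// ltW.
  - apply/measurable_EFinP; apply: measurable_funD => //.
    by apply: measurable_funM => //; exact: measurable_indic.
  - exact/measurable_EFinP.
  - move=> w _; rewrite lee_fin /f indicE; case: (boolP (w \in _)) => [/set_mem//=|_].
      by rewrite mulr1.
    by rewrite mulr0 addr0.
rewrite /f; under eq_integral do rewrite EFinD EFinM.
rewrite ge0_integralD//=; last 2 first.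
- by move=> w _; rewrite -EFinM lee_fin mulr_ge0// ltW.
- by apply: emeasurable_funM => //; apply/measurable_EFinP; exact: measurable_indic.
rewrite integral_cst//= probability_setT mule1 addeC leeD2l//.
rewrite ge0_integralZl_EFin ?(ltW a0)//; last first.
  by apply/measurable_EFinP; exact: measurable_indic.
by rewrite integral_indic// setIT EFinM lee_wpmul2l ?lee_fin ?ltW.
Qed.

End probable_gap.

(** * Change of measure for coin flips *)

Section change_of_measure.
Context {R : realType}.

Lemma bernoulli_iid_integralS (q : R) n (g : n.+1.-tuple bool -> R) :
  0 <= q <= 1 -> measurable_fun setT g -> (forall w, 0 <= g w <= 1) ->
  \int[iid_law (bernoulli_prob q) n.+1]_w g w =
  q * \int[iid_law (bernoulli_prob q) n]_w g (cons_pair (true, w)) +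
  (1 - q) * \int[iid_law (bernoulli_prob q) n]_w g (cons_pair (false, w)).
Proof.
move=> q01 mg g01.
have mgs s : measurable_fun setT (fun w : n.-tuple bool => g (cons_pair (s, w))).
  apply: (measurableT_comp (f := g \o @cons_pair bool n) (g := fun w => (s, w))).
    by apply: measurableT_comp => //; exact: measurable_cons_pairT.
  exact: measurable_pair1.
have fin s : (\int[iid_law (bernoulli_prob q) n]_w (g (cons_pair (s, w)))%:E)%E \is a fin_num.
  apply: integrable_fin_num => //.
  apply: (le_integrableR (g := fun=> 1)) => //; last exact: integrableR_cst.
  by move=> w; have /andP[g0 g1] := g01 (cons_pair (s, w)); rewrite ger0_norm.
rewrite /Rintegral iid_law_integralS; last 2 first.
- exact/measurable_EFinP.
- by move=> w; rewrite lee_fin; have /andP[] := g01 w.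
rewrite integral_bernoulli_prob//; last first.
  by move=> s; apply: integral_ge0 => w _; rewrite lee_fin; have /andP[] := g01 (cons_pair (s, w)).
by rewrite fineD ?fineM ?fin_numM.
Qed.

(* [4 q (1 - q)] is the inverse of the second moment of the likelihood ratio
   of [bernoulli_prob (1/2)] with respect to [bernoulli_prob q]. *)
Lemma bernoulli_iid_change_of_measure (q : R) n (g : n.-tuple bool -> R) :
  0 <= q <= 1 -> measurable_fun setT g -> (forall w, 0 <= g w <= 1) ->
  (4 * q * (1 - q)) ^+ n * (\int[iid_law (bernoulli_prob (1 / 2)) n]_w g w) ^+ 2 <=
  \int[iid_law (bernoulli_prob q) n]_w g w.
Proof.
move=> q01; have /andP[q0 q1] := q01.
have h01 : 0 <= (1 / 2 : R) <= 1 by apply/andP; split; lra.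
elim: n g => [|n ih] g mg g01.
  (* Without samples the claim is [g ^ 2 <= g], true for values in [0, 1]. *)
  rewrite expr0 mul1r /Rintegral !iid_law_integral0//=; try exact/measurable_EFinP.
  by have /andP[g0 g1] := g01 [tuple]; rewrite expr2 ler_piMr.
rewrite !bernoulli_iid_integralS//.
have mgs s : measurable_fun setT (fun w : n.-tuple bool => g (cons_pair (s, w))).
  apply: (measurableT_comp (f := g \o @cons_pair bool n) (g := fun w => (s, w))).
    by apply: measurableT_comp => //; exact: measurable_cons_pairT.
  exact: measurable_pair1.
have := ih _ (mgs true) (fun w => g01 _); have := ih _ (mgs false) (fun w => g01 _).
set a := \int[_]_w g (cons_pair (true, w)); set b := \int[_]_w g (cons_pair (false, w)).
set a' := \int[_]_w g (cons_pair (true, w)); set b' := \int[_]_w g (cons_pair (false, w)).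
set K := (4 * q * (1 - q)) ^+ n => hb ha.
have q1' : 0 <= 1 - q by rewrite subr_ge0.
apply: (@le_trans _ _ (q * (K * a ^+ 2) + (1 - q) * (K * b ^+ 2))); last first.
  by rewrite lerD// ler_wpM2l.
have K0 : 0 <= K by rewrite exprn_ge0// !mulr_ge0.
(* Two-point Cauchy-Schwarz: [q a ^ 2 + (1 - q) b ^ 2] exceeds [4 q (1 - q) ((a + b) / 2) ^ 2] by
   exactly this square. *)
have h : 0 <= K * (q * a - (1 - q) * b) ^+ 2 by rewrite mulr_ge0 ?sqr_ge0.
rewrite exprS -/K -subr_ge0 [X in 0 <= X](_ : _ = K * (q * a - (1 - q) * b) ^+ 2)//.
by field.
Qed.

End change_of_measure.

(** * The hard instances *)

Section hard_instance.
Context {R : realType} (L B e : R).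
Hypotheses (L0 : 0 < L) (B0 : 0 < B) (e0 : 0 < e) (e1 : e <= 1 / 4).

Local Notation rV1 := 'rV[R]_1.

Definition hard_center (s : bool) : R := if s then B else - B.

(** For a fair coin the mean of the first terms is constant on [-B, B]; the small term [e * |x|]
    singles out 0. It is too weak to stop a coin of bias [e] from moving the minimizer to an
    endpoint. *)
Definition hard_f (x : rV1) (s : bool) : R :=
  L / 2 * (`|x 0 0 - hard_center s| + e * `|x 0 0|).

Definition sign_ge0 (t : R) : R := if 0 <= t then 1 else - 1.

Definition hard_grad (x : rV1) (s : bool) : rV1 :=
  \row__ (L / 2 * (sign_ge0 (x 0 0 - hard_center s) + e * sign_ge0 (x 0 0))).

Lemma sign_ge0_subgradient (s t : R) : `|t| + sign_ge0 t * (s - t) <= `|s|.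
Proof.
rewrite /sign_ge0; case: ifPn => [t0|].
  by rewrite ger0_norm//; have := ler_norm s; lra.
rewrite -ltNge => t0; rewrite ltr0_norm//.
by have := ler_norm (- s); rewrite normrN; lra.
Qed.

Lemma normr_sign_ge0 (t : R) : `|sign_ge0 t| = 1.
Proof. by rewrite /sign_ge0; case: ifP => _; rewrite ?normrN normr1. Qed.

Lemma measurable_sign_ge0 {dO} {O : measurableType dO} (h : O -> R) :
  measurable_fun setT h -> measurable_fun setT (fun w => sign_ge0 (h w)).
Proof. by move=> mh; apply: measurable_fun_ifT => //; exact: measurable_fun_ler. Qed.

Lemma enorm_rV1 (x : rV1) : enorm x = `|x 0 0|.
Proof. by rewrite /enorm /dotv big_ord1 -expr2 sqrtr_sqr. Qed.

Lemma hard_dist_le (u v c : R) :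
  `|(`|u - c| + e * `|u|) - (`|v - c| + e * `|v|)| <= 2 * `|u - v|.
Proof.
have h1 : `| `|u - c| - `|v - c| | <= `|u - v|.
  by rewrite (le_trans (ler_dist_dist _ _))// opprB addrA subrK.
have h2 : `| `|u| - `|v| | <= `|u - v| by exact: ler_dist_dist.
rewrite (_ : _ - _ = (`|u - c| - `|v - c|) + e * (`|u| - `|v|)); last by ring.
rewrite (le_trans (ler_normD _ _))// normrM (ger0_norm (ltW e0)).
have := ler_wpM2l (ltW e0) h2.
have e1' : e <= 1 by move: e1; lra.
have : e * `|u - v| <= 1 * `|u - v| by rewrite ler_wpM2r.
lra.
Qed.

Lemma hard_f_ge0 x s : 0 <= hard_f x s.
Proof. by rewrite mulr_ge0 ?divr_ge0 ?addr_ge0 ?mulr_ge0// ltW. Qed.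

Lemma hard_grad_subgradient x s y :
  hard_f x s + dotv (hard_grad x s) (y - x) <= hard_f y s.
Proof.
rewrite /dotv big_ord1 !mxE /hard_f.
have h1 := sign_ge0_subgradient (y 0 0 - hard_center s) (x 0 0 - hard_center s).
have h2 := sign_ge0_subgradient (y 0 0) (x 0 0).
rewrite -[X in _ + X <= _]mulrA -mulrDr ler_wpM2l ?divr_ge0 ?(ltW L0)//.
have := ler_wpM2l (ltW e0) h2; lra.
Qed.

Lemma measurable_hard_grad : measurable_fun setT (fun p : rV1 * bool => hard_grad p.1 p.2).
Proof.
have mx : measurable_fun setT (fun p : rV1 * bool => p.1 0 0).
  exact: (measurableT_comp (coord_measurable 0)).
have mc : measurable_fun setT (fun p : rV1 * bool => hard_center p.2).
  by apply: measurable_fun_ifT => //; exact: measurable_snd.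
apply/measurable_fun_rVP => i; under eq_fun do rewrite mxE.
apply: measurable_funM => //; apply: measurable_funD.
  by apply: measurable_sign_ge0; exact: measurable_funB.
by apply: measurable_funM => //; exact: measurable_sign_ge0.
Qed.

Lemma measurable_from_bool (h : bool -> R) : measurable_fun setT h.
Proof. by []. Qed.

Section law.
Variable q : R.

Let hard_integrable (x : rV1) : [set: rV1] x ->
  (bernoulli_prob q).-integrable setT (fun s => (hard_f x s)%:E).
Proof.
move=> _; apply: (le_integrableR (g := fun _ => hard_f x true + hard_f x false)).
- exact: measurable_from_bool.
- move=> s; rewrite ger0_norm ?hard_f_ge0//.
  by case: s; rewrite ?lerDl ?lerDr hard_f_ge0.
- exact: integrableR_cst.
Qed.

Let hard_grad_measurable : measurable_fun ([set: rV1] `*` [set: bool])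
  (fun p : rV1 * bool => hard_grad p.1 p.2).
Proof. by rewrite setXTT; exact: measurable_hard_grad. Qed.

Definition hard_instance : so_instance [set: rV1] :=
  @SoInstance R 1 setT _ bool (bernoulli_prob q) hard_f hard_grad
    hard_integrable hard_grad_measurable
    (fun s _ x _ y _ => hard_grad_subgradient x s y).

Lemma hard_convex : so_convex hard_instance.
Proof.
move=> s; apply/convex_functionP => x y t _ _ /andP[t0 t1] /=.
have t1' : 0 <= 1 - t by rewrite subr_ge0.
have h u v c : `|t * u + (1 - t) * v - c| <= t * `|u - c| + (1 - t) * `|v - c|.
  rewrite (_ : _ - c = t * (u - c) + (1 - t) * (v - c)); last by ring.
  by rewrite (le_trans (ler_normD _ _))// !normrM (ger0_norm t0) (ger0_norm t1').
rewrite /hard_f !mxE mulrCA [X in _ <= _ + X]mulrCA -mulrDr.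
rewrite ler_wpM2l ?divr_ge0 ?(ltW L0)//.
have h1 := h (x 0 0) (y 0 0) (hard_center s).
have := h (x 0 0) (y 0 0) 0; rewrite !subr0 => /(ler_wpM2l (ltW e0)); lra.
Qed.

Lemma hard_lipschitz s : elipschitz_on setT L (so_f hard_instance ^~ s).
Proof.
move=> x y _ _; rewrite enorm_rV1 !mxE /= /hard_f.
rewrite -mulrBr normrM ger0_norm ?divr_ge0 ?(ltW L0)//.
move: (x 0 0 : R) (y 0 0 : R) (hard_center s) => u v c.
have := hard_dist_le u v c.
move=> /(ler_wpM2l (_ : 0 <= L / 2)) h; apply: le_trans (h _) _.
  by rewrite divr_ge0// ltW.
by rewrite mulrA divfK.
Qed.

Lemma hard_grad_bounded s x : enorm (so_grad hard_instance x s) <= L.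
Proof.
rewrite enorm_rV1 mxE normrM ger0_norm ?divr_ge0 ?(ltW L0)//.
have : `|sign_ge0 (x 0 0 - hard_center s) + e * sign_ge0 (x 0 0)| <= 2.
  rewrite (le_trans (ler_normD _ _))// normrM !normr_sign_ge0 (ger0_norm (ltW e0)).
  by move: e1; lra.
move=> /(ler_wpM2l (_ : 0 <= L / 2)) h; apply: le_trans (h _) _.
  by rewrite divr_ge0// ltW.
by rewrite divfK.
Qed.

Hypothesis q01 : 0 <= q <= 1.

Lemma hard_objectiveE x : so_objective hard_instance x =
  L / 2 * (q * `|x 0 0 - B| + (1 - q) * `|x 0 0 + B| + e * `|x 0 0|).
Proof.
rewrite /so_objective unlock integral_bernoulli_prob//=; last first.
  by move=> s; rewrite lee_fin hard_f_ge0.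
rewrite -[LHS]/(q * hard_f x true + (1 - q) * hard_f x false).
by rewrite /hard_f /hard_center opprK; ring.
Qed.

Lemma hard_instance_Lip z :
  (forall x, so_objective hard_instance z <= so_objective hard_instance x) ->
  enorm z <= B -> instances_Lip L B hard_instance.
Proof.
move=> zmin zB; split.
- exact: hard_convex.
- exact: hard_lipschitz.
- by move=> s x _; exact: hard_grad_bounded.
- apply: (@le_trans _ _ (enorm z)%:E); last by rewrite lee_fin.
  by apply: ereal_inf_lbound; exists z.
Qed.

Lemma hard_so_inf z : (forall x, so_objective hard_instance z <= so_objective hard_instance x) ->
  so_inf hard_instance = (so_objective hard_instance z)%:E.
Proof.
move=> zmin; apply/eqP; rewrite eq_le; apply/andP; split.
  by apply: ereal_inf_lbound; exists z.
by apply: le_ereal_inf_tmp => _ [y _ <-]; rewrite lee_fin.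
Qed.

End law.

(* Any two of the three sets where the excess is below [L B e / 4] are disjoint. *)
Lemma hard_gap (q : R) : q = 1 / 2 \/ q = 1 / 2 + e \/ q = 1 / 2 - e ->
  let G t := L / 2 * (q * `|t - B| + (1 - q) * `|t + B| + e * `|t|) in
  exists2 z, `|z| <= B & (forall t, G z <= G t) /\
    (forall t, (if q == 1 / 2 then B / 2 <= `|t|
      else if q == 1 / 2 + e then t <= B / 2 else - (B / 2) <= t) ->
      G z + L * B * e / 4 <= G t).
Proof.
have L2 : 0 <= L / 2 by rewrite divr_ge0// ltW.
have nB : `|B| = B by rewrite ger0_norm// ltW.
have LBe : L * B * e / 4 = L / 2 * (B * e / 2) by field.
have tp t : t + B <= `|t + B| by exact: ler_norm.
have tm t : B - t <= `|t - B| by rewrite distrC ler_norm.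
have tp' t : - t - B <= `|t + B| by rewrite -normrN opprD ler_norm.
have tm' t : t - B <= `|t - B| by exact: ler_norm.
have et t : e * t <= e * `|t| by rewrite ler_wpM2l ?ler_norm// ltW.
have et' t : - (e * t) <= e * `|t| by rewrite -mulrN -normrN; exact: et.
have et0 (t : R) : 0 <= e * `|t| by rewrite mulr_ge0// ltW.
have p1 : 0 <= 1 / 2 + e by move: e0; lra.
have p2 : 0 <= 1 / 2 - e by move: e1; lra.
move=> qE G; rewrite /G LBe; case: qE => [->|[->|->]].
- exists 0; rewrite ?normr0 ?(ltW B0)// eqxx sub0r add0r normrN nB mulr0 addr0.
  split=> [t|t /(ler_wpM2l (ltW e0)) tB].
    by rewrite ler_wpM2l//; have := tp t; have := tm t; have := et0 t; lra.
  by rewrite -mulrDr ler_wpM2l//; have := tp t; have := tm t; lra.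
- have ne : 1 / 2 + e == 1 / 2 = false by apply/negbTE; rewrite gt_eqF// ltrDl.
  (* Up to the factor [L / 2] the slope is [-2 e + e = - e] on (0, B), steeper to the left and
     positive beyond B. So every [t <= B / 2] has excess at least [e B / 2]; the case [1 / 2 - e] is
     the mirror image. *)
  exists B; rewrite ?nB// ne eqxx subrr normr0 mulr0 add0r.
  have -> : `|B + B| = B + B by rewrite ger0_norm// addr_ge0// ltW.
  split=> [t|t tB].
    rewrite ler_wpM2l//.
    have := ler_wpM2l p2 (tp t); have [tB|Bt] := leP t B.
      have := ler_wpM2l p1 (tm t); have := et t.
      have := ler_wpM2l (ltW e0) tB; lra.
    have := ler_wpM2l p1 (tm' t); have := et t; have := ler_wpM2l (ltW e0) (ltW Bt); lra.
  rewrite -mulrDr ler_wpM2l//.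
  have := ler_wpM2l p2 (tp t); have := ler_wpM2l p1 (tm t); have := et t.
  have := ler_wpM2l (ltW e0) tB; lra.
- have ne : 1 / 2 - e == 1 / 2 = false by apply/negbTE; rewrite lt_eqF// gtrBl.
  have ne' : 1 / 2 - e == 1 / 2 + e = false by apply/negbTE; rewrite lt_eqF//; move: e0; lra.
  exists (- B); rewrite ?normrN ?nB// ne ne' addNr normr0 mulr0 addr0.
  have -> : `|- B - B| = B + B.
    by rewrite -opprD normrN ger0_norm// addr_ge0// ltW.
  split=> [t|t tB].
    rewrite ler_wpM2l//.
    have := ler_wpM2l p2 (tm t); have [tB|Bt] := leP (- B) t.
      have := ler_wpM2l p1 (tp t); have := et' t.
      have := ler_wpM2l (ltW e0) tB; lra.
    have := ler_wpM2l p1 (tp' t); have := et' t; have := ler_wpM2l (ltW e0) (ltW Bt); lra.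
  rewrite -mulrDr ler_wpM2l//.
  have := ler_wpM2l p2 (tm t); have := ler_wpM2l p1 (tp t); have := et' t.
  have := ler_wpM2l (ltW e0) tB; lra.
Qed.

End hard_instance.

Lemma three_quarters {R : realType} (a : R) : a <= 1 / 4 -> 3 / 4 <= 1 - a.
Proof. by move=> h; lra. Qed.

Lemma quarter_of_half {R : realType} (a b : R) : a + b < 1 / 2 -> 1 / 4 < a -> b <= 1 / 4.
Proof. by move=> h1 h2; lra. Qed.

(** * A probable gap on one of three instances *)

Section lower_bound.
Context {R : realType} (L B : R).
Hypotheses (L0 : 0 < L) (B0 : 0 < B).

Section event.
Context {T : nat} {dS : measure_display} {S : measurableType dS}.
Variable E : set (T.-tuple S * measurableTypeR R).
Hypothesis mE : measurable E.

Let g (w : T.-tuple S) : R := fine (uniform_prob (@ltr01 R) (xsection E w)).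

Let g01 w : 0 <= g w <= 1.
Proof.
have mx : measurable (xsection E w) by exact: measurable_xsection.
rewrite /g fine_ge0//= -lee_fin fineK ?fin_num_measure//.
exact: probability_le1.
Qed.

Let mg : measurable_fun setT g.
Proof.
apply: (measurableT_comp (fine_measurable (R := R) measurableT)) => //.
exact: measurable_fun_xsection.
Qed.

(** Averaging over the internal randomness turns an event into a [0, 1]-valued function of the
    samples. The same [f] serves every law [P], so the change of measure applies to randomized
    algorithms. *)
Lemma section_probability : exists f : T.-tuple S -> R,
  [/\ measurable_fun setT f, forall w, 0 <= f w <= 1 &
   forall P : probability S R,
     fine ((iid_law P T \x uniform_prob (@ltr01 R))%E E) = \int[iid_law P T]_w f w].
Proof.
exists g; split => // P; congr fine; apply: eq_integral => w _ /=.
rewrite fineK// fin_num_measure//; exact: measurable_xsection.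
Qed.

End event.

(** One construction serves both errors: [del] is the quantile level in one case and 1/4 in the
    other. The instance is chosen after the algorithm. *)
Lemma hard_gap_probable (e del : R) (T : nat) (alg : so_alg R 1 T) :
  0 < e -> e <= 1 / 4 -> del < 1 / 2 -> del < 9 / 16 * (1 - 4 * e ^+ 2) ^+ T ->
  @algs_SO R 1 T setT alg ->
  exists2 I, @instances_Lip R 1 setT L B I & exists m,
    [/\ so_inf I = m%:E, 0 <= m,
      measurable_fun setT (fun w => so_objective I (@so_output R 1 T setT alg I w)),
      forall w, m <= so_objective I (@so_output R 1 T setT alg I w) &
      (del%:E < run_law T I
        [set w | (m + L * B * e / 4 <= so_objective I (@so_output R 1 T setT alg I w))%R])%E].
Proof.
move=> e0 e1 del2 delT [_ malg].
pose I q := hard_instance B L0 e0 q.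
(* The instances differ only in their law, so the output on [I (1 / 2)] is, by conversion, the same
   function of bits and internal randomness on every [I q]. *)
pose t (w : T.-tuple bool * measurableTypeR R) : R :=
  @so_output R 1 T setT alg (I (1 / 2)) w 0 0.
have mt : measurable_fun setT t.
  have := malg (I (1 / 2)) (@hard_convex R L B e L0 e0 (1 / 2)).
  by move/measurable_fun_rVP/(_ 0).
pose bad q : set (T.-tuple bool * measurableTypeR R) :=
  [set w | if q == 1 / 2 then B / 2 <= `|t w|
    else if q == 1 / 2 + e then t w <= B / 2 else - (B / 2) <= t w].
have mbad q : measurable (bad q).
  have mnt : measurable_fun setT (fun w => `|t w|) by exact: measurableT_comp.
  rewrite /bad -[X in measurable X]setTI.
  by case: (q == 1 / 2); [|case: (q == 1 / 2 + e)]; exact: measurable_fun_le.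
suff [q qE badq] : exists2 q : R, q = 1 / 2 \/ q = 1 / 2 + e \/ q = 1 / 2 - e &
    (del%:E < run_law T (I q) (bad q))%E.
  have q01 : 0 <= q <= 1 by case: qE => [->|[->|->]]; apply/andP; split; lra.
  have [z zB [zmin zgap]] := hard_gap L0 B0 e0 e1 qE.
  pose zv : 'rV[R]_1 := const_mx z.
  have zvmin x : so_objective (I q) zv <= so_objective (I q) x.
    by rewrite !hard_objectiveE// mxE; exact: zmin.
  exists (I q).
    by apply: (hard_instance_Lip e1 zvmin); rewrite enorm_rV1 mxE.
  have m0 : measurable_fun setT
      (fun w => so_objective (I q) (@so_output R 1 T setT alg (I q) w)).
    under eq_fun do rewrite hard_objectiveE//.
    apply: measurable_funM => //; apply: measurable_funD; last first.
      by apply: measurable_funM => //; exact: (measurableT_comp _ mt).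
    apply: measurable_funD; apply: measurable_funM => //.
      by apply: measurableT_comp => //; exact: measurable_funB.
    by apply: measurableT_comp => //; exact: measurable_funD.
  exists (so_objective (I q) zv); split.
  - exact: hard_so_inf.
  - rewrite hard_objectiveE//; have /andP[q0 q1] := q01.
    by rewrite mulr_ge0 ?divr_ge0 ?addr_ge0 ?mulr_ge0 ?subr_ge0// ltW.
  - exact: m0.
  - by move=> w; exact: zvmin.
  - apply: lt_le_trans badq _; apply: le_measure; rewrite ?inE//.
      by rewrite -[X in measurable X]setTI; exact: measurable_fun_le.
    by move=> w /zgap /=; rewrite !hard_objectiveE// mxE.
have Pfin q (A : set (T.-tuple bool * measurableTypeR R)) : measurable A ->
    run_law T (I q) A \is a fin_num by move=> mA; exact: fin_num_measure.
have transfer q : q = 1 / 2 + e \/ q = 1 / 2 - e ->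
    3 / 4 <= fine (run_law T (I (1 / 2)) (bad q)) -> (del%:E < run_law T (I q) (bad q))%E.
  move=> qE h; have q01 : 0 <= q <= 1 by case: qE => ->; apply/andP; split; lra.
  have [f [mf f01 fE]] := section_probability (mbad q).
  have := bernoulli_iid_change_of_measure q01 mf f01.
  have := fE (bernoulli_prob (1 / 2)); have := fE (bernoulli_prob q).
  rewrite -/(run_law T (I q)) -/(run_law T (I (1 / 2))) => <- <-.
  have -> : 4 * q * (1 - q) = 1 - 4 * e ^+ 2 by case: qE => ->; field.
  move=> h'; rewrite -(fineK (Pfin _ _ (mbad q))) lte_fin.
  apply: lt_le_trans delT (le_trans _ h'); rewrite mulrC ler_wpM2l//.
    by rewrite exprn_ge0//; nra.
  rewrite (_ : 9 / 16 = (3 / 4) ^+ 2); last by field.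
  by rewrite ler_pXn2r ?nnegrE//; lra.
have [half|half] := leP (1 / 2) (fine (run_law T (I (1 / 2)) (bad (1 / 2)))).
  exists (1 / 2); first by left.
  by rewrite -(fineK (Pfin _ _ (mbad _))) lte_fin (lt_le_trans del2).
have ne1 : 1 / 2 + e == 1 / 2 = false by apply/negbTE; rewrite gt_eqF// ltrDl.
have ne2 : 1 / 2 - e == 1 / 2 = false by apply/negbTE; rewrite lt_eqF// gtrBl.
have ne3 : 1 / 2 - e == 1 / 2 + e = false by apply/negbTE; rewrite lt_eqF//; lra.
have mC q : measurable (~` bad q) by exact: measurableC.
have complE q : fine (run_law T (I (1 / 2)) (bad q)) =
    1 - fine (run_law T (I (1 / 2)) (~` bad q)).
  rewrite -[bad q in LHS]setCK probability_setC// fineB//.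
  exact: Pfin.
(* The two complements are [t > B / 2] and [t < - (B / 2)]: disjoint, and both inside [bad (1 / 2)],
   which has probability below 1/2. Hence one of them has probability at most 1/4. *)
have far : fine (run_law T (I (1 / 2)) (~` bad (1 / 2 + e))) +
    fine (run_law T (I (1 / 2)) (~` bad (1 / 2 - e))) < 1 / 2.
  apply: le_lt_trans half; rewrite -fineD ?Pfin//.
  have disj : ~` bad (1 / 2 + e) `&` ~` bad (1 / 2 - e) = set0.
    apply/seteqP; split=> // w [] /=; rewrite /bad /= ne1 eqxx ne2 ne3.
    move=> /negP; rewrite -ltNge => h1 /negP; rewrite -ltNge => h2.
    by move: B0 h1 h2; lra.
  have mU : measurable (~` bad (1 / 2 + e) `|` ~` bad (1 / 2 - e)) by exact: measurableU.
  rewrite -(measureU _ (mC _) (mC _) disj).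
  apply: (fine_le (Pfin _ _ mU) (Pfin _ _ (mbad _))).
  apply: le_measure; [by rewrite inE|by rewrite inE; exact: mbad|].
  move=> w; rewrite /bad /= ne1 !eqxx ne2 ne3 => -[] /negP; rewrite -ltNge => h.
    by rewrite (le_trans _ (ler_norm _))// ltW.
  by rewrite -normrN (le_trans _ (ler_norm _))// lerNr ltW.
have [near|far1] := leP (fine (run_law T (I (1 / 2)) (~` bad (1 / 2 + e)))) (1 / 4).
  exists (1 / 2 + e); first by right; left.
  refine (transfer (1 / 2 + e) (or_introl erefl) _).
  by rewrite complE; exact: three_quarters.
exists (1 / 2 - e); first by right; right.
refine (transfer (1 / 2 - e) (or_intror erefl) _).
rewrite complE; apply: three_quarters.
exact: (quarter_of_half far far1).
Qed.

End lower_bound.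

(** * The lower rates *)

Section lower_rates.
Context {R : realType}.

(** [expR (2 x) >= 1 + 2 x], and [(1 - x) (1 + 2 x) = 1 + x (1 - 2 x)] is at least 1. *)
Lemma expRN_le_onem (x : R) : 0 <= x -> x <= 1 / 2 -> expR (- (2 * x)) <= 1 - x.
Proof.
move=> x0 x1; rewrite expRN -[leLHS]div1r ler_pdivrMr ?expR_gt0//.
have h := expR_ge1Dx (2 * x).
have x1' : 0 <= 1 - x by lra.
by apply: le_trans (ler_wpM2l x1' h); nra.
Qed.

Lemma onem_exp_ge (x : R) n : 0 <= x -> x <= 1 / 2 ->
  expR (- (2 * x * n%:R)) <= (1 - x) ^+ n.
Proof.
move=> x0 x1; rewrite -mulNr expRM_natr lerXn2r ?nnegrE ?expR_ge0//; first lra.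
exact: expRN_le_onem.
Qed.

(** With [y] the eighth root of [del] the claim is [y ^ 7 < 9 / 16]. Raised to the power 8 it
    follows from [del ^ 7 < (1 / 2) ^ 7 < (9 / 16) ^ 8]; the room left at [del] near 1/2 is
    small. *)
Lemma lt_half_expR_eighth (del : R) : 0 < del -> del < 1 / 2 ->
  del < 9 / 16 * expR (- (ln (1 / del) / 8)).
Proof.
move=> d0 d2; set y := expR _.
have y0 : 0 < y by exact: expR_gt0.
have y8 : y ^+ 8 = del.
  rewrite /y -expRM_natr mulNr divfK// div1r lnV// opprK lnK//.
rewrite -[X in X < _]y8 exprSr ltr_pM2r// ltNge; apply/negP => h.
have : (9 / 16) ^+ 8 <= (y ^+ 7) ^+ 8 by rewrite lerXn2r// ?nnegrE ?exprn_ge0// ltW.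
rewrite -exprM mulnC exprM y8 => h'.
have : del ^+ 7 < (1 / 2) ^+ 7 by rewrite ltrXn2r// ltW.
move/(le_lt_trans h'); rewrite !exprS expr0; lra.
Qed.

Variables (L B : R) (T : nat).
Hypotheses (L0 : 0 < L) (B0 : 0 < B) (T0 : (0 < T)%N).

Lemma SO_quantile_lower (del : R) (alg : so_alg R 1 T) : 0 < del -> del < 1 / 2 ->
  @algs_SO R 1 T setT alg -> exists2 I, @instances_Lip R 1 setT L B I &
  ((1 / 256 * (L * B / Num.sqrt (1 + T%:R / ln (1 / del))))%:E <= err_quantile del alg I)%E.
Proof.
move=> d0 d2 Aalg; have T0' : 0 < T%:R :> R by rewrite ltr0n.
set l := ln (1 / del).
have l0 : 0 < l by rewrite ln_gt0// div1r invf_gt1//; lra.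
have Tl0 : 0 < T%:R / l by rewrite divr_gt0.
set q := Num.sqrt (1 + T%:R / l).
have q2 : q ^+ 2 = 1 + T%:R / l by rewrite sqr_sqrtr// ltW// addr_gt0.
have q1 : 1 <= q.
  by rewrite -sqrtr1 ler_sqrt ?lerDl ?ltW// addr_gt0.
have q0 : 0 < q by exact: lt_le_trans q1.
(* The bias makes [2 (4 e ^ 2) T = T / (8 q ^ 2)], at most [l / 8], the exponent allowed by
   [lt_half_expR_eighth]. The 1 inside [q] keeps [e] bounded when [T] is small. *)
pose e := 1 / 8 / q.
have e0 : 0 < e by rewrite !divr_gt0.
have e1 : e <= 1 / 4 by rewrite ler_pdivrMr//; lra.
have eT : 2 * (4 * e ^+ 2) * T%:R <= l / 8.
  rewrite (_ : 2 * (4 * e ^+ 2) * T%:R = T%:R / q ^+ 2 / 8); last first.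
    by rewrite /e; field; rewrite gt_eqF.
  rewrite ler_pM2r// q2 ler_pdivrMr ?addr_gt0// mulrDr mulr1 mulrC divfK ?gt_eqF//.
  by rewrite lerDr ltW.
have delT : del < 9 / 16 * (1 - 4 * e ^+ 2) ^+ T.
  apply: lt_le_trans (lt_half_expR_eighth d0 d2) _; rewrite ler_wpM2l//.
  apply: le_trans (onem_exp_ge T _ _); first by rewrite ler_expR lerN2.
    by rewrite mulr_ge0// sqr_ge0.
  nra.
have [I LI [m [infm m0 mY mleY gap]]] := hard_gap_probable L0 B0 e0 e1 d2 delT Aalg.
exists I => //; rewrite /err_quantile infm.
have a0 : 0 < L * B * e / 4 by rewrite divr_gt0// mulr_gt0// mulr_gt0.
apply: le_trans (quantile_gap_ge mY gap); rewrite lee_fin.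
have -> : L * B * e / 4 = 1 / 32 * (L * B / q) by rewrite /e; field; rewrite gt_eqF.
rewrite ler_wpM2r//; first by rewrite divr_ge0 ?mulr_ge0// ltW.
lra.
Qed.

Lemma SO_mean_lower (alg : so_alg R 1 T) :
  @algs_SO R 1 T setT alg -> exists2 I, @instances_Lip R 1 setT L B I &
  ((1 / 256 * (L * B / Num.sqrt T%:R))%:E <= err_mean alg I)%E.
Proof.
move=> Aalg; have T0' : 0 < T%:R :> R by rewrite ltr0n.
set q := Num.sqrt T%:R.
have q2 : q ^+ 2 = T%:R by rewrite sqr_sqrtr// ltW.
have q1 : 1 <= q by rewrite -sqrtr1 ler_sqrt// ler1n.
have q0 : 0 < q by exact: lt_le_trans q1.
(* Now [8 e ^ 2 T = 1 / 32], so the likelihood factor stays near 1 and level 1/4 is reached. The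
   mean gap is [(L B e / 4) (1 / 4)], which gives the constant 1/256. *)
pose e := 1 / 16 / q.
have e0 : 0 < e by rewrite !divr_gt0.
have e1 : e <= 1 / 4 by rewrite ler_pdivrMr//; lra.
have eT : 2 * (4 * e ^+ 2) * T%:R = 1 / 32.
  by rewrite -q2 /e; field; rewrite gt_eqF.
have d2 : 1 / 4 < 1 / 2 :> R by lra.
have delT : 1 / 4 < 9 / 16 * (1 - 4 * e ^+ 2) ^+ T.
  have : expR (- (1 / 32)) <= (1 - 4 * e ^+ 2) ^+ T.
    rewrite -eT; apply: onem_exp_ge; first by rewrite mulr_ge0// sqr_ge0.
    nra.
  have := expR_ge1Dx (- (1 / 32) : R); lra.
have [I LI [m [infm m0 mY mleY gap]]] := hard_gap_probable L0 B0 e0 e1 d2 delT Aalg.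
exists I => //; rewrite /err_mean infm.
have a0 : 0 < L * B * e / 4 by rewrite divr_gt0// mulr_gt0// mulr_gt0.
apply: le_trans (expectation_gap_ge mY a0 gap m0 mleY); rewrite lee_fin.
rewrite le_eqVlt; apply/orP; left; apply/eqP; rewrite /e; field; rewrite gt_eqF//.
Qed.

End lower_rates.

Theorem proposition1 (R : realType) :
  exists c C : R, [/\ 0 < c, c <= C &
    forall (L B : R) (T : nat), 0 < L -> 0 < B -> (0 < T)%N ->
    (* upper bounds, for every closed convex domain containing the origin *)
    (forall (d : nat) (X : set 'rV[R]_d),
      (0 < d)%N -> closed X -> convex_set X -> X 0 ->
      forall (insts : so_instance X -> Prop) (algs : set (so_alg R d T)),
      insts = @instances_Lip R d X L B \/ insts = @instances_SMLip R d X L B ->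
      algs = @algs_SO R d T X \/ algs = @algs_SFO R d T X ->
      (minimax_err (@err_mean R d T X) algs insts
         <= (C * (L * B / Num.sqrt T%:R))%:E)%E /\
      (forall delta : R, 0 < delta -> delta < 1 / 2 ->
        (minimax_err (@err_quantile R d T X delta) algs insts
           <= (C * (L * B / Num.sqrt (1 + T%:R / ln (1 / delta))))%:E)%E)) /\
    (* lower bounds, for the domain R = R^1 *)
    (forall (insts : so_instance [set: 'rV[R]_1] -> Prop)
        (algs : set (so_alg R 1 T)),
      insts = @instances_Lip R 1 setT L B \/
        insts = @instances_SMLip R 1 setT L B ->
      algs = @algs_SO R 1 T setT \/ algs = @algs_SFO R 1 T setT ->
      ((c * (L * B / Num.sqrt T%:R))%:E
         <= minimax_err (@err_mean R 1 T setT) algs insts)%E /\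
      (forall delta : R, 0 < delta -> delta < 1 / 2 ->
        ((c * (L * B / Num.sqrt (1 + T%:R / ln (1 / delta))))%:E
           <= minimax_err (@err_quantile R 1 T setT delta) algs insts)%E))].
Proof.
have E0 : 0 < expR 2 :> R by exact: expR_gt0.
(* The lower constant is the one of the mean bound, below the 1/32 of the quantile bound; the upper
   constant is the sum of the mean and quantile constants. *)
exists (1 / 256), (20 * expR 2 + 120); split; [lra|lra|].
move=> L B T L0 B0 T0; have LB0 : 0 < L * B by exact: mulr_gt0.
split.
  move=> d X d0 clX cvX X0 insts algs instsE algsE.
  have instsS I : insts I -> @instances_SMLip R d X L B I.
    by case: instsE => -> // /(instances_LipW clX L0).
  have algsS : @algs_SFO R d T X `<=` algs.
    by case: algsE => -> //; exact: algs_SFO_sub_SO.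
  split=> [|delta del0 del2].
    apply: le_trans (minimax_err_mono _ algsS instsS) _.
    apply: le_trans (minimax_err_mean_le clX cvX X0 L0 B0 T0) _.
    by rewrite lee_fin ler_wpM2r ?divr_ge0 ?sqrtr_ge0 ?(ltW LB0)//; lra.
  apply: le_trans (minimax_err_mono _ algsS instsS) _.
  apply: le_trans (minimax_err_quantile_le clX cvX X0 L0 B0 T0 del0 del2) _.
  by rewrite lee_fin ler_wpM2r ?divr_ge0 ?sqrtr_ge0 ?(ltW LB0)//; lra.
move=> insts algs instsE algsE.
(* The opposite reduction to the one for the upper bounds: defeat every general algorithm already on
   the smaller, Lipschitz class. *)
have instsS I : @instances_Lip R 1 setT L B I -> insts I.
  by case: instsE => -> //; apply: instances_LipW => //; exact: closedT.
have algsS : algs `<=` @algs_SO R 1 T setT.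
  by case: algsE => -> //; apply: algs_SFO_sub_SO => //; exact: closedT.
split=> [|delta del0 del2]; apply: le_minimax_err => alg /algsS Aalg.
  by have [I /instsS] := SO_mean_lower L0 B0 T0 Aalg; exists I.
by have [I /instsS] := SO_quantile_lower L0 B0 T0 del0 del2 Aalg; exists I.
Qed.
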